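(* Consider the linear regression model $y=X\theta+u$ (context). Suppose that for a given $i\ge1$ with $i\le k=k(n)$ for all large enough $n$ we have $\xi_{i,n}\eta_{i,n}\to0$, $n-k\to\infty$, and $n^{1/2}\eta_{i,n}/(n-k)^{1/2}\to0$. Let $a_{i,n}$ be any sequence of non-negative reals, $E_{AS,i,n}=[\tilde\theta_{AS,i}-\hat\sigma a_{i,n},\tilde\theta_{AS,i}+\hat\sigma a_{i,n}]$ and $C_{AS,i,n}=[\hat\theta_{AS,i}-\sigma a_{i,n},\hat\theta_{AS,i}+\sigma a_{i,n}]$. Then, for any $\sigma>0$, $$\inf_{\theta\in\mathbb{R}^k,\sigma'\in(0,\infty)}P_{n,\theta,\sigma'}(\theta_i\in E_{AS,i,n})-\inf_{\theta\in\mathbb{R}^k}P_{n,\theta,\sigma}(\theta_i\in C_{AS,i,n})\longrightarrow0\quad(n\to\infty).$$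
   Context: Model: for each $n$, $y=X\theta+u$ with $y\in\mathbb{R}^n$, $X$ a non-stochastic $n\times k$ matrix of rank $k\ge1$ ($k=k(n)$ and all entries may depend on $n$), $\theta\in\mathbb{R}^k$, $u\sim N(0,\sigma^2I_n)$, $\sigma>0$. $P_{n,\theta,\sigma}$ is the probability under $(\theta,\sigma)$. $\hat\theta_{LS}=(X'X)^{-1}X'y$, $\hat\sigma^2=(y-X\hat\theta_{LS})'(y-X\hat\theta_{LS})/(n-k)$ (for $n>k$), $\xi_{i,n}\ge0$ with $\xi_{i,n}^2=((X'X/n)^{-1})_{ii}$. Standing assumption for asymptotic results: $\sup_n\xi_{i,n}^2/n<\infty$. Tuning parameters $\eta_{i,n}>0$. Adaptive soft-thresholding: known-variance $\hat\theta_{AS,i}=\hat\theta_{LS,i}(1-\sigma^2\xi_{i,n}^2\eta_{i,n}^2/\hat\theta_{LS,i}^2)_+$, feasible $\tilde\theta_{AS,i}=\hat\theta_{LS,i}(1-\hat\sigma^2\xi_{i,n}^2\eta_{i,n}^2/\hat\theta_{LS,i}^2)_+$. *)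

(* Defs.v *)
From HB Require Import structures.
From mathcomp Require Import all_boot all_order all_algebra.
From mathcomp Require Import all_classical all_reals all_analysis.
From mathcomp Require Import normal_distribution.
Set Implicit Arguments. Unset Strict Implicit. Unset Printing Implicit Defensive.
Import Order.TTheory GRing.Theory Num.Theory.
Import numFieldNormedType.Exports.
Local Open Scope classical_set_scope.
Local Open Scope ring_scope.

Fixpoint gauss_iter {R : realType} (m : nat) (f : (nat -> R) -> \bar R) : \bar R :=
  match m with
  | 0 => f (fun _ => 0)
  | m'.+1 => (\int[normal_prob 0 1]_x
                gauss_iter m' (fun z => f (fun j => if j is j'.+1 then z j' else x)))%E
  end.

Definition std_gauss {R : realType} (n : nat) (A : set 'cV[R]_n) : \bar R :=
  gauss_iter n (fun z => (\1_A (\col_(l < n) z (nat_of_ord l)) : R)%:E).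

Definition Pmodel {R : realType} (n k : nat) (X : 'M[R]_(n, k)) (theta : 'cV[R]_k)
  (sigma : R) (E : set 'cV[R]_n) : \bar R :=
  std_gauss [set z | E (X *m theta + sigma *: z)].

Definition coordv {R : realType} (m : nat) (v : 'cV[R]_m) (j : nat) : R :=
  if (insub j : option 'I_m) is Some l then v l 0 else 0.

Definition diagm {R : realType} (m : nat) (M : 'M[R]_m) (j : nat) : R :=
  if (insub j : option 'I_m) is Some l then M l l else 0.

Definition theta_LS {R : realType} (n k : nat) (X : 'M[R]_(n, k)) (y : 'cV[R]_n)
  : 'cV[R]_k := invmx (X^T *m X) *m X^T *m y.

Definition sigma2_hat {R : realType} (n k : nat) (X : 'M[R]_(n, k)) (y : 'cV[R]_n) : R :=
  let r := y - X *m theta_LS X y in ((r^T *m r) 0 0) / (n%:R - k%:R).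

Definition xi2 {R : realType} (n k : nat) (X : 'M[R]_(n, k)) (j : nat) : R :=
  diagm (invmx (n%:R^-1 *: (X^T *m X))) j.
Definition xi {R : realType} (n k : nat) (X : 'M[R]_(n, k)) (j : nat) : R :=
  Num.sqrt (xi2 X j).

Definition soft_AS {R : realType} (n k : nat) (X : 'M[R]_(n, k)) (eta s2 : R)
  (j : nat) (y : 'cV[R]_n) : R :=
  let t := coordv (theta_LS X y) j in
  t * Num.max 0 (1 - s2 * xi2 X j * eta ^+ 2 / t ^+ 2).

Definition theta_AS {R : realType} (n k : nat) (X : 'M[R]_(n, k)) (eta sigma : R)
  (j : nat) (y : 'cV[R]_n) : R := soft_AS X eta (sigma ^+ 2) j y.

Definition ttheta_AS {R : realType} (n k : nat) (X : 'M[R]_(n, k)) (eta : R)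
  (j : nat) (y : 'cV[R]_n) : R := soft_AS X eta (sigma2_hat X y) j y.

Definition E_AS {R : realType} (n k : nat) (X : 'M[R]_(n, k)) (eta a : R) (j : nat)
  (theta : 'cV[R]_k) : set 'cV[R]_n :=
  [set y | ttheta_AS X eta j y - Num.sqrt (sigma2_hat X y) * a <= coordv theta j
           <= ttheta_AS X eta j y + Num.sqrt (sigma2_hat X y) * a].

Definition C_AS {R : realType} (n k : nat) (X : 'M[R]_(n, k)) (eta sigma a : R) (j : nat)
  (theta : 'cV[R]_k) : set 'cV[R]_n :=
  [set y | theta_AS X eta sigma j y - sigma * a <= coordv theta j
           <= theta_AS X eta sigma j y + sigma * a].

Definition inf_cov_E {R : realType} (n k : nat) (X : 'M[R]_(n, k)) (eta a : R) (j : nat)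
  : \bar R :=
  ereal_inf [set Pmodel X theta s' (E_AS X eta a j theta) | theta in [set: 'cV[R]_k] & s' in [set s' : R | 0 < s']].

Definition inf_cov_C {R : realType} (n k : nat) (X : 'M[R]_(n, k)) (eta sigma a : R)
  (j : nat) : \bar R :=
  ereal_inf [set Pmodel X theta sigma (C_AS X eta sigma a j theta) | theta in [set: 'cV[R]_k]].

(* Main.v *)
(* Let s^2 be the i-th diagonal entry of (X'X)^-1, let
   G = (theta_LS,i - theta_i) / (sigma s), a linear form in the standard Gaussian
   noise, and D^2 = sigma2_hat / sigma^2.  With S_b the adaptive soft threshold,
   b = sqrt n * eta, A = a / s and t = theta_i / (sigma s), the two coverage events are
     |S_b (t + G) - t| <= A   and   |S_(D b) (t + G) - t| <= D A.
   No independence of G and D is needed.  S_b is 2-Lipschitz in b, monotone, and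
   expands distances away from its zero set; so when |D - 1| is small, moving |t|
   away from 0 by a small amount turns either event into the other up to G lying
   in two short intervals.  The shift is needed because the coverage is
   discontinuous at |t| = A: the infima are close although the pointwise
   coverages are not.  The intervals have small probability because
   E exp (- l (G - c)^2 / 2) is explicit, and E (D^2 - 1)^2 = 2 / (n - k).  If A
   exceeds b by much, |S_b x - x| <= b makes both coverages close to 1. *)
Require Import Defs.
From HB Require Import structures.
From mathcomp Require Import all_boot all_order all_algebra.
From mathcomp Require Import all_classical all_reals all_analysis.
From mathcomp Require Import normal_distribution.
From mathcomp Require Import measurable_realfun ring lra.
Import Order.TTheory GRing.Theory Num.Theory.
Import numFieldNormedType.Exports.
Local Open Scope classical_set_scope.
Local Open Scope ring_scope.

(** * Integration against a normal law *)

Section standard_normal.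
Context {R : realType}.
Local Notation mu := (@lebesgue_measure R).
Implicit Types (f : R -> R) (m s x : R).

(** The Radon-Nikodym derivative of the normal law agrees almost everywhere with [normal_pdf],
    because both have the same integral over every measurable set. *)
Lemma ge0_integral_normal_prob m s (f : measurableTypeR R -> \bar R) :
  measurable_fun setT f -> (forall x, (0 <= f x)%E) ->
  (\int[normal_prob m s]_x f x = \int[mu]_x (f x * (normal_pdf m s x)%:E))%E.
Proof.
move=> mf f0.
have dom := @normal_prob_dominates R m s.
rewrite -(Radon_Nikodym_SigmaFinite.change_of_variables dom)//.
have mh := Radon_Nikodym_SigmaFinite.f_integrable dom.
apply: ae_eq_integral => //.
- by apply: emeasurable_funM => //; exact: measurable_int mh.
- apply: emeasurable_funM => //; apply/measurable_EFinP.
  exact: measurable_normal_pdf.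
- apply: ae_eqe_mul2l; apply: integral_ae_eq => //.
  + by apply/measurable_EFinP; exact: measurable_normal_pdf.
  + by move=> E _ mE; rewrite -Radon_Nikodym_SigmaFinite.f_integral.
Qed.

Lemma ge0_integral_oppr (f : measurableTypeR R -> \bar R) :
  measurable_fun setT f -> (forall x, (0 <= f x)%E) ->
  (\int[mu]_x f (- x)%R = \int[mu]_x f x)%E.
Proof.
move=> mf f0.
rewrite -[LHS](@ge0_integral_pushforward _ _ (measurableTypeR R) (measurableTypeR R) R -%R _ mu setT f)//.
by apply: eq_measure_integral => //= A mA _; exact: lebesgue_measureN.
Qed.

Lemma normal_pdf_oppr s x : s != 0 -> normal_pdf 0 s (- x) = normal_pdf 0 s x.
Proof. by move=> s0; rewrite !normal_pdfE// /normal_fun !subr0 sqrrN. Qed.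

Lemma ge0_integral_normal_oppr s (f : measurableTypeR R -> \bar R) : s != 0 ->
  measurable_fun setT f -> (forall x, (0 <= f x)%E) ->
  (\int[normal_prob 0 s]_x f (- x)%R = \int[normal_prob 0 s]_x f x)%E.
Proof.
move=> s0 mf f0; rewrite !ge0_integral_normal_prob//; last first.
  by apply: measurableT_comp.
rewrite -(ge0_integral_oppr (fun x => f x * (normal_pdf 0 s x)%:E)%E); last 2 first.
- apply: emeasurable_funM => //; apply/measurable_EFinP.
  exact: measurable_normal_pdf.
- by move=> x; rewrite mule_ge0// lee_fin normal_pdf_ge0.
by apply: eq_integral => x _; rewrite normal_pdf_oppr.
Qed.

Lemma ge0_integral_normal01 (f : R -> R) :
  measurable_fun [set: R] f -> (forall x, 0 <= f x) ->
  (\int[normal_prob 0 1]_x (f x)%:E =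
   \int[mu]_x ((f x * normal_pdf 0 1 x)%:E))%E.
Proof.
move=> mf f0; rewrite ge0_integral_normal_prob//.
exact/measurable_EFinP.
Qed.

Lemma normal_pdf01 x : normal_pdf 0 1 x = normal_peak 1 * expR (- (x ^+ 2 / 2)).
Proof. by rewrite normal_pdfE ?oner_eq0// /normal_fun subr0 expr1n mulNr. Qed.

(** Completing the square turns the integrand times the density into a constant times a normal
    density of variance [1 / v], where [v = 1 + l * w ^+ 2]. The result has the shape of the
    integrand, with [l] replaced by [l / v], so the formula can be iterated. *)
Lemma integral_normal_expR_sqr (l w c : R) : 0 <= l ->
  (\int[normal_prob 0 1]_x (expR (- (l * (w * x + c) ^+ 2 / 2)))%:E =
   ((Num.sqrt (1 + l * w ^+ 2))^-1 *
     expR (- (l / (1 + l * w ^+ 2) * c ^+ 2 / 2)))%:E)%E.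
Proof.
move=> l0; rewrite ge0_integral_normal01; last 2 first.
- apply: measurableT_comp => //; apply: measurable_funN.
  apply: measurable_funM => //; apply: measurable_funM => //.
  apply: measurable_funX => //; apply: measurable_funD => //.

- by move=> x; exact: expR_ge0.
set v := 1 + l * w ^+ 2.
have v0 : 0 < v by rewrite ltr_pwDl// mulr_ge0// sqr_ge0.
set sv := Num.sqrt v.
have sv0 : 0 < sv by rewrite sqrtr_gt0.
have svE : sv ^+ 2 = v by rewrite sqr_sqrtr// ltW.
set k := _ * expR _.
have k0 : 0 <= k by rewrite mulr_ge0 ?invr_ge0 ?expR_ge0// ltW.
transitivity (\int[mu]_x (k%:E * (normal_pdf (- (l * w * c / v)) sv^-1 x)%:E))%E.
  apply: eq_integral => x _; rewrite -EFinM; congr EFin.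
  rewrite normal_pdf01 normal_pdfE ?invr_eq0 ?gt_eqF// /normal_fun /normal_peak /k.
  rewrite exprVn svE expr1n.
  have -> : Num.sqrt (v^-1 * pi *+ 2) = sv^-1 * Num.sqrt (1 * pi *+ 2) :> R.
    rewrite -mulrnAr sqrtrM ?invr_ge0 ?(ltW v0)// sqrtrV ?(ltW v0)//.
    by rewrite mul1r.
  set P := Num.sqrt _.
  have P0 : P != 0 by rewrite gt_eqF// sqrtr_gt0 mul1r mulrn_wgt0// pi_gt0.
  have vn0 : 1 + l * w ^+ 2 != 0 by rewrite gt_eqF.
  have E : expR (- (l * (w * x + c) ^+ 2 / 2)) * expR (- (x ^+ 2 / 2)) =
     expR (- (l / v * c ^+ 2 / 2)) *
     expR (- (x - - (l * w * c / v)) ^+ 2 / (v^-1 *+ 2)).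
    rewrite -!expRD; congr expR; rewrite -[v^-1 *+ 2]mulr_natr /v.
    by field.
  have svn0 : sv != 0 by rewrite gt_eqF.
  transitivity (P^-1 * (expR (- (l * (w * x + c) ^+ 2 / 2)) * expR (- (x ^+ 2 / 2)))).
    by rewrite mulrCA.
  by rewrite E; field; rewrite svn0 P0.
rewrite ge0_integralZl//.
- by rewrite integral_normal_pdf mule1.
- by apply/measurable_EFinP; exact: measurable_normal_pdf.
- by move=> x _; rewrite lee_fin normal_pdf_ge0.
Qed.
End standard_normal.

(** * Second and fourth moments of the standard normal law *)

Section normal_moments.
Context {R : realType}.
Local Notation mu := (@lebesgue_measure R).
Implicit Types (f : R -> R) (m s x : R).

Local Notation phi := (normal_pdf (0 : R) 1).

Lemma is_derive_normal_pdf01 x : is_derive x (1 : R) phi (- x * phi x).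
Proof.
have -> : phi = normal_peak 1 *: (expR \o (fun y : R => - (y ^+ 2 / 2))) :> (R -> R).
  by apply/funext => y; rewrite normal_pdf01.
have h : is_derive x (1 : R) (fun y : R => - (y ^+ 2 / 2)) (- x).
  have -> : (fun y : R => - (y ^+ 2 / 2)) = (- 2^-1) *: ((id : R -> R) ^+ 2) :> (R -> R).
    apply/funext => y; change (- (y ^+ 2 / 2) = - 2^-1 * ((id : R -> R) ^+ 2) y).
    by rewrite exprfctE mulrC mulNr.
  apply: is_derive_eq; rewrite /GRing.scale/= !mulr1 expr1.
  by rewrite mulNr mulrA mulVf ?mul1r// pnatr_eq0.
apply: is_derive_eq.
by rewrite /GRing.scale/= mulrA [in RHS]mulrC.
Qed.

Lemma is_derive_LRcontinuous (F f : R -> R) a b :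
  (forall x, is_derive x (1 : R) F (f x)) ->
  derivable_oo_LRcontinuous F a b /\ {in `]a, b[, F^`()%classic =1 f}.
Proof.
move=> Ff.
have cF x : {for x, continuous F}.
  by apply: differentiable_continuous; apply/derivable1_diffP; have [] := Ff x.
split; last by move=> x _; rewrite derive1E; apply: derive_val.
split.
- by move=> x _; have [] := Ff x.
- by apply: cvg_at_right_filter; exact: cF.
- by apply: cvg_at_left_filter; exact: cF.
Qed.

(** Controls the boundary term of the integration by parts below. Since exp (y^2 / 2) is the fourth
    power of exp (y^2 / 8), it is at least (y^2 / 8)^4, which beats y^7 by a factor of order y. *)
Lemma cvg_exprn_normal_pdf k : (k <= 3)%N ->
  (n%:R ^+ k * phi n%:R) @[n --> \oo] --> (0 : R).
Proof.
move=> k3.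
have bound n : (0 < n)%N -> n%:R ^+ k * phi n%:R <= 8 ^+ 4 * normal_peak 1 * n%:R^-1.
  move=> n0; set y : R := n%:R.
  have y1 : 1 <= y by rewrite ler1n.
  have y0 : 0 < y by rewrite (lt_le_trans ltr01).
  have e4 : expR (y ^+ 2 / 2) = expR (y ^+ 2 / 8) ^+ 4.
    by rewrite -expRM_natl; congr expR; field.
  have e1 : y ^+ 2 / 8 <= expR (y ^+ 2 / 8).
    by rewrite (le_trans _ (expR_ge1Dx _))// lerDr.
  have e8 : (y ^+ 2 / 8) ^+ 4 <= expR (y ^+ 2 / 2).
    by rewrite e4 lerXn2r// ?nnegrE ?expR_ge0// divr_ge0// sqr_ge0.
  rewrite normal_pdf01 expRN mulrCA.
  rewrite [X in _ <= X](_ : _ = normal_peak 1 * (8 ^+ 4 * y^-1)); last by ring.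
  rewrite ler_wpM2l ?normal_peak_ge0// ler_pdivrMr ?expR_gt0//.
  apply: (@le_trans _ _ (8 ^+ 4 * y^-1 * (y ^+ 2 / 8) ^+ 4)); last first.
    by rewrite ler_wpM2l// mulr_ge0 ?exprn_ge0 ?invr_ge0 ?ler0n ?(ltW y0).
  have -> : 8 ^+ 4 * y^-1 * (y ^+ 2 / 8) ^+ 4 = y ^+ 7.
    by field; rewrite gt_eqF.
  by rewrite ler_weXn2l// (leq_trans k3).
apply: (@squeeze_cvgr _ _ _ _ (fun=> 0) (fun n => 8 ^+ 4 * normal_peak 1 * n%:R^-1)).
- near=> n; apply/andP; split.
    by rewrite mulr_ge0 ?exprn_ge0 ?normal_pdf_ge0.
  by apply: bound; near: n; exact: nbhs_infty_gt.
- exact: cvg_cst.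
- rewrite -[X in _ --> X](mulr0 (8 ^+ 4 * normal_peak 1)).
  apply: cvgM; first exact: cvg_cst.
  apply/gtr0_cvgV0; last exact: cvgr_idn.
  by near=> n; rewrite ltr0n; near: n; exact: nbhs_infty_gt.
Unshelve. all: by end_near. Qed.

Lemma continuous_exprn_normal_pdf k : continuous (fun x => x ^+ k * phi x).
Proof.
move=> x; apply: cvgM; first exact: exprn_continuous.
by apply: continuous_normal_pdf; rewrite oner_eq0.
Qed.

(** Integration by parts of x^(k+1) against x phi(x), whose primitive is - phi. As [k] is even the
    integrands are nonnegative, and monotone convergence passes from bounded intervals to the
    half-line. *)
Lemma half_moment_step k (e : R) : (k <= 2)%N -> ~~ odd k ->
  (\int[mu]_(x in `[0%R, +oo[) (x ^+ k * phi x)%:E = e%:E)%E ->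
  (\int[mu]_(x in `[0%R, +oo[) (x ^+ k.+2 * phi x)%:E = (k.+1%:R * e)%:E)%E.
Proof.
move=> k2 ek eE.
have p0 j x : ~~ odd j -> 0 <= x ^+ j * phi x.
  by move=> oj; rewrite mulr_ge0 ?normal_pdf_ge0// exprn_even_ge0.
have mp j : measurable_fun [set: R] (fun x => x ^+ j * phi x).
  by apply: continuous_measurable_fun; exact: continuous_exprn_normal_pdf.
have ek2 : ~~ odd k.+2 by rewrite /= negbK.
(* The endpoint [n.+1] keeps the interval nondegenerate; [cvg_shiftS] removes the shift in the
   limit. *)
have ibp n : (\int[mu]_(x in `[0%R, n.+1%:R]) (x ^+ k.+2 * phi x)%:E =
   (- (n.+1%:R ^+ k.+1 * phi n.+1%:R))%:E +
   k.+1%:R%:E * \int[mu]_(x in `[0%R, n.+1%:R]) (x ^+ k * phi x)%:E)%E.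
  have dF x : is_derive x (1 : R) (fun y : R => y ^+ k.+1) (k.+1%:R * x ^+ k).
    have -> : (fun y : R => y ^+ k.+1) = (id : R -> R) ^+ k.+1.
      by apply/funext => y /=; rewrite exprfctE.
    by apply: is_derive_eq; rewrite /GRing.scale/= mulr1.
  have dG x : is_derive x (1 : R) (fun y : R => - phi y) (x * phi x).
    have := is_derive_normal_pdf01 x => ?.
    have -> : (fun y : R => - phi y) = - phi :> (R -> R) by [].
    by apply: is_derive_eq; rewrite mulNr opprK.
  have [F1 F2] := @is_derive_LRcontinuous _ _ 0 n.+1%:R dF.
  have [G1 G2] := @is_derive_LRcontinuous _ _ 0 n.+1%:R dG.
  have cf : {within `[0, n.+1%:R], continuous (fun x : R => k.+1%:R * x ^+ k)}.
    apply: continuous_subspaceT => x.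
    by apply: cvgM; [exact: cvg_cst|exact: exprn_continuous].
  have cg : {within `[0, n.+1%:R], continuous (fun x : R => x * phi x)}.
    by apply: continuous_subspaceT; exact: (@continuous_exprn_normal_pdf 1).
  have := integration_by_parts (ltr0Sn R n) cf F1 F2 cg G1 G2.
  under eq_integral do rewrite mulrA -exprSr.
  move=> ->; rewrite expr0n/= mul0r subr0 mulrN; congr (_ + _)%E.
  under eq_integral do rewrite mulrN EFinN.
  rewrite integral_ge0N; last first.
    by move=> x _; rewrite lee_fin -mulrA mulr_ge0// p0.
  rewrite oppeK.
  under eq_integral do rewrite -mulrA EFinM.
  rewrite ge0_integralZl//.
  - by apply/measurable_EFinP; apply: measurable_funTS; exact: mp.
  - by move=> x _; rewrite lee_fin p0.
have c1 := @ge0_cvgn_integral R mu _ (fun x => p0 k.+2 x ek2) (mp k.+2).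
have c0 := @ge0_cvgn_integral R mu _ (fun x => p0 k x ek) (mp k).
rewrite eE in c0.
have {}c1 : (\int[mu]_(x in `[0%R, n.+1%:R]) (x ^+ k.+2 * phi x)%:E)%E @[n --> \oo]
    --> (\int[mu]_(x in `[0%R, +oo[) (x ^+ k.+2 * phi x)%:E)%E.
  by rewrite (cvg_shiftS (fun n => \int[mu]_(x in `[0%R, n%:R]) (x ^+ k.+2 * phi x)%:E)%E).
rewrite (funext ibp) in c1.
apply: (cvg_unique _ c1) => //=.
have -> : (k.+1%:R * e)%:E = ((- 0)%:E + k.+1%:R%:E * e%:E)%E.
  by rewrite oppr0 add0e EFinM.
apply: cvgeD.
- by rewrite fin_num_adde_defr.
- apply: cvg_EFin; first by near=> n.
  apply: cvgN; rewrite (cvg_shiftS (fun n => n%:R ^+ k.+1 * phi n%:R)).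
  by apply: cvg_exprn_normal_pdf.
- by apply: cvgeZl => //; rewrite (cvg_shiftS (fun n => \int[mu]_(x in `[0%R, n%:R]) (x ^+ k * phi x)%:E)%E).
Unshelve. all: by end_near. Qed.

Lemma normal_moment_half k (e : R) : ~~ odd k ->
  (\int[mu]_(x in `[0%R, +oo[) (x ^+ k * phi x)%:E = e%:E)%E ->
  (\int[normal_prob 0 1]_x (x ^+ k)%:E = (2 * e)%:E)%E.
Proof.
move=> ek eE; rewrite ge0_integral_normal01; last 2 first.
- exact: exprn_measurable.
- by move=> x; rewrite exprn_even_ge0.
rewrite (@ge0_symfun_integralT R (fun x => x ^+ k * phi x)).
- rewrite (_ : [set x | _] = `[0, +oo[%classic); last first.
    by apply/seteqP; split => x/=; rewrite in_itv/= andbT.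
  by rewrite eE.
- by move=> x; rewrite mulr_ge0 ?normal_pdf_ge0// exprn_even_ge0.
- exact: continuous_exprn_normal_pdf.
- move=> x /=; rewrite normal_pdf_oppr ?oner_eq0// -mulN1r exprMn.
  by rewrite -signr_odd (negbTE ek) expr0 mul1r.
Qed.

Lemma half_moment0 :
  (\int[mu]_(x in `[0%R, +oo[) (x ^+ 0 * phi x)%:E = (2^-1)%:E)%E.
Proof.
have := @integral_normal_pdf R 0 1.
rewrite (@ge0_symfun_integralT R phi).
- rewrite (_ : [set x | _] = `[0, +oo[%classic); last first.
    by apply/seteqP; split => x/=; rewrite in_itv/= andbT.
  under [in X in _ -> X]eq_integral do rewrite expr0 mul1r.
  have : (0 <= \int[mu]_(x in `[0%R, +oo[) (phi x)%:E)%E.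
    by apply: integral_ge0 => x _; rewrite lee_fin normal_pdf_ge0.
  case: (integral _ _ _) => [r _||] //.
  + by rewrite -EFinM => -[r1]; congr EFin; rewrite -(@mulKf _ 2 _ r)// r1 mulr1.
  + by rewrite mulry gtr0_sg// mul1e.
- by move=> x; exact: normal_pdf_ge0.
- by apply: continuous_normal_pdf; rewrite oner_eq0.
- by move=> x /=; rewrite normal_pdf_oppr ?oner_eq0.
Qed.

Lemma normal_moment2 : (\int[normal_prob (0 : R) 1]_x (x ^+ 2)%:E = 1)%E.
Proof.
rewrite (normal_moment_half 2 _ isT (half_moment_step 0 _ isT isT half_moment0))//.
by congr EFin; field.
Qed.

Lemma normal_moment4 : (\int[normal_prob (0 : R) 1]_x (x ^+ 4)%:E = 3%:E)%E.
Proof.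
rewrite (normal_moment_half 4 _ isT (half_moment_step 2 _ isT isT (half_moment_step 0 _ isT isT half_moment0)))//.
by congr EFin; field.
Qed.

(** Odd moments are avoided: p(x) and p(-x) have the same integral by symmetry of the law, and their
    sum contains even powers only. Nonnegativity of p lets the integral be split without
    integrability of the odd terms. *)
Lemma ge0_integral_normal_quartic (c0 c1 c2 c3 c4 : R) :
  (forall x, 0 <= c0 + c1 * x + c2 * x ^+ 2 + c3 * x ^+ 3 + c4 * x ^+ 4) ->
  (\int[normal_prob (0 : R) 1]_x
     (c0 + c1 * x + c2 * x ^+ 2 + c3 * x ^+ 3 + c4 * x ^+ 4)%:E =
   (c0 + c2 + 3 * c4)%:E)%E.
Proof.
move=> p0; set N := normal_prob 0 1.
pose p x := c0 + c1 * x + c2 * x ^+ 2 + c3 * x ^+ 3 + c4 * x ^+ 4.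
have mX k (c : R) : measurable_fun [set: R] (fun x : R => c * x ^+ k).
  by apply: measurable_funM => //; exact: exprn_measurable.
have mp : measurable_fun [set: R] p.
  apply: measurable_funD; last exact: mX.
  apply: measurable_funD; last exact: mX.
  apply: measurable_funD; last exact: mX.
  by apply: measurable_funD => //; exact: (mX 1%N).
have mpN : measurable_fun [set: R] (fun x => p (- x)).
  exact: measurableT_comp.
have iX k : ~~ odd k -> (\int[N]_x (x ^+ k)%:E < +oo)%E ->
    N.-integrable setT (fun x => (x ^+ k)%:E).
  move=> ek fin; apply/integrableP; split.
    by apply/measurable_EFinP; exact: exprn_measurable.
  under eq_integral do rewrite /= ger0_norm ?exprn_even_ge0//.
  exact: fin.
have i2 := iX 2%N erefl; rewrite normal_moment2 ltry in i2.
have i4 := iX 4%N erefl; rewrite normal_moment4 ltry in i4.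
have {}i2 := i2 erefl; have {}i4 := i4 erefl.
have even_part : (\int[N]_x (p x + p (- x))%:E = (2 * c0 + 2 * c2 + 6 * c4)%:E)%E.
  transitivity (\int[N]_x ((2 * c0)%:E + ((2 * c2)%:E * (x ^+ 2)%:E
       + (2 * c4)%:E * (x ^+ 4)%:E)))%E.
    by apply: eq_integral => x _; rewrite -!EFinM -!EFinD /p; congr EFin; ring.
  rewrite integralD//; last 2 first.
  - exact: finite_measure_integrable_cst.
  - by apply: integrableD => //; apply: integrableZl.
  rewrite integralD//; [|exact: integrableZl..].
  rewrite integral_cst// [X in (_ * X)%E](_ : _ = 1%E); last exact: probability_setT.
  rewrite mule1 !integralZl//.
  rewrite normal_moment2 normal_moment4 mule1 -EFinM -!EFinD; congr EFin; ring.
have dbl : (\int[N]_x (p x)%:E + \int[N]_x (p x)%:E = (2 * c0 + 2 * c2 + 6 * c4)%:E)%E.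
  rewrite -even_part.
  under [RHS]eq_integral do rewrite EFinD.
  rewrite ge0_integralD//.
  - congr (_ + _)%E; rewrite -(@ge0_integral_normal_oppr R 1 (fun x => (p x)%:E)) ?oner_eq0//.
    exact/measurable_EFinP.
  - by move=> x _; rewrite lee_fin; exact: p0.
  - exact/measurable_EFinP.
  - by move=> x _; rewrite lee_fin; exact: p0.
  - exact/measurable_EFinP.
move: dbl; rewrite -/(p _).
(* Twice an infinite value is infinite, so [dbl] leaves only the finite case. *)
case: (integral _ _ _) => [r| |]//; rewrite -EFinD => -[h]; congr EFin.
lra.
Qed.
End normal_moments.

(** * Iterated Gaussian integrals *)

Definition scons {R : realType} (x : R) (z : nat -> R) : nat -> R :=
  fun j => if j is j'.+1 then z j' else x.

(* Measurability for the product sigma-algebra on sequences, tested on all maps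
   with measurable coordinates instead of constructing that sigma-algebra. *)
Definition coord_measurable2 {R : realType} {d} {T : measurableType d}
  (F : T -> (nat -> R) -> R) : Prop :=
  forall d' (T' : measurableType d') (psi : T' -> T) (z : T' -> nat -> R),
    measurable_fun setT psi -> (forall j, measurable_fun setT (fun t => z t j)) ->
    measurable_fun setT (fun t => F (psi t) (z t)).

Definition coord_measurable {R : realType} (f : (nat -> R) -> R) : Prop :=
  forall d (T : measurableType d) (z : T -> nat -> R),
    (forall j, measurable_fun setT (fun t => z t j)) ->
    measurable_fun setT (fun t => f (z t)).

Section gauss_iter.
Context {R : realType}.
Local Notation N := (normal_prob (0 : R) 1).
Implicit Types (f g : (nat -> R) -> R).

Lemma gauss_iterS m (f : (nat -> R) -> \bar R) :
  gauss_iter m.+1 f = (\int[N]_x gauss_iter m (fun z => f (scons x z)))%E.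
Proof. by []. Qed.

Lemma gauss_iter_ge0 m (f : (nat -> R) -> \bar R) :
  (forall z, (0 <= f z)%E) -> (0 <= gauss_iter m f)%E.
Proof.
elim: m f => [|m IH] f f0; first exact: f0.
by rewrite gauss_iterS; apply: integral_ge0 => x _; exact: IH.
Qed.

Lemma eq_gauss_iter m (f g : (nat -> R) -> \bar R) :
  (forall z, f z = g z) -> gauss_iter m f = gauss_iter m g.
Proof. by move=> fg; congr gauss_iter; apply/funext. Qed.

Lemma gauss_iter_cst m (c : R) : gauss_iter m (fun=> c%:E) = c%:E.
Proof.
elim: m => [//|m IH]; rewrite gauss_iterS IH integral_cst//.
by rewrite [X in (_ * X)%E](_ : _ = 1%E) ?mule1//; exact: probability_setT.
Qed.

(** The induction generalises over the parameter space: the first noise coordinate joins the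
    parameter in a product space, and Tonelli integrates it out. *)
Lemma measurable_gauss_iter m d (T : measurableType d) (F : T -> (nat -> R) -> R) :
  (forall t z, 0 <= F t z) -> coord_measurable2 F ->
  measurable_fun setT (fun t => gauss_iter m (fun z => (F t z)%:E)).
Proof.
elim: m d T F => [|m IH] d T F F0 mF.
  apply/measurable_EFinP; apply: (mF _ _ id (fun=> fun=> 0)) => // j.
under eq_fun do rewrite gauss_iterS.
pose G (p : T * measurableTypeR R) z := F p.1 (scons p.2 z).
have mG : measurable_fun setT (fun p : T * measurableTypeR R => gauss_iter m (fun z => (G p z)%:E)).
  apply: IH => [p z|d' T' psi z mpsi mz]; first exact: F0.
  apply: (mF _ _ (fun t => (psi t).1) (fun t => scons (psi t).2 (z t))).
    exact: measurableT_comp.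
  by move=> [|j] /=; [exact: measurableT_comp|exact: mz].
apply: (measurable_fun_fubini_tonelli_F (fun p : T * measurableTypeR R => gauss_iter m (fun z => (G p z)%:E))) => //.
by move=> p; apply: gauss_iter_ge0 => z; rewrite lee_fin F0.
Qed.

Lemma measurable_gauss_iter_scons m f :
  (forall z, 0 <= f z) -> coord_measurable f ->
  measurable_fun [set: measurableTypeR R]
    (fun x => gauss_iter m (fun z => (f (scons x z))%:E)).
Proof.
move=> f0 mf; apply: measurable_gauss_iter => [x z|d T psi z mpsi mz].
  exact: f0.
by apply: mf => -[|j] /=; [exact: mpsi|exact: mz].
Qed.

Lemma coord_measurable_scons f x : coord_measurable f -> coord_measurable (fun z => f (scons x z)).
Proof.
by move=> mf d T z mz; apply: mf => -[|j] /=; [exact: measurable_cst|exact: mz].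
Qed.

Lemma gauss_iterD m f g :
  (forall z, 0 <= f z) -> coord_measurable f -> (forall z, 0 <= g z) -> coord_measurable g ->
  gauss_iter m (fun z => (f z + g z)%:E) =
  (gauss_iter m (fun z => (f z)%:E) + gauss_iter m (fun z => (g z)%:E))%E.
Proof.
elim: m f g => [//|m IH] f g f0 mf g0 mg; rewrite !gauss_iterS.
rewrite -ge0_integralD//.
- apply: eq_integral => x _; apply: IH => //; exact: coord_measurable_scons.
- by move=> x _; apply: gauss_iter_ge0 => z; rewrite lee_fin.
- exact: measurable_gauss_iter_scons.
- by move=> x _; apply: gauss_iter_ge0 => z; rewrite lee_fin.
- exact: measurable_gauss_iter_scons.
Qed.

Lemma gauss_iterZl m f (c : R) : 0 <= c -> (forall z, 0 <= f z) -> coord_measurable f ->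
  gauss_iter m (fun z => (c * f z)%:E) = (c%:E * gauss_iter m (fun z => (f z)%:E))%E.
Proof.
move=> c0; elim: m f => [//|m IH] f f0 mf; rewrite !gauss_iterS.
rewrite -ge0_integralZl//.
- apply: eq_integral => x _; apply: IH => //; exact: coord_measurable_scons.
- exact: measurable_gauss_iter_scons.
- by move=> x _; apply: gauss_iter_ge0 => z; rewrite lee_fin.
Qed.

Lemma le_gauss_iter m f g :
  (forall z, 0 <= f z) -> coord_measurable f -> coord_measurable g -> (forall z, f z <= g z) ->
  (gauss_iter m (fun z => (f z)%:E) <= gauss_iter m (fun z => (g z)%:E))%E.
Proof.
elim: m f g => [f g _ _ _ fg|m IH f g f0 mf mg fg]; first by rewrite lee_fin.
have g0 z : 0 <= g z by rewrite (le_trans (f0 z)).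
rewrite !gauss_iterS; apply: ge0_le_integral => //.
- by move=> x _; apply: gauss_iter_ge0 => z; rewrite lee_fin.
- exact: measurable_gauss_iter_scons.
- exact: measurable_gauss_iter_scons.
- by move=> x _; apply: IH => //; exact: coord_measurable_scons.
Qed.

(** This is the Laplace transform of the square of a normal variable with mean [c]. The shift is
    arbitrary because, in the induction, the contribution of the first coordinate is absorbed into
    it; the one-dimensional formula then applies with [l / (1 + l * v)]. *)
Lemma gauss_iter_expR_sqr m (w : nat -> R) (l c : R) : 0 <= l ->
  gauss_iter m (fun z => (expR (- (l * ((\sum_(j < m) w j * z j) + c) ^+ 2 / 2)))%:E) =
  ((Num.sqrt (1 + l * \sum_(j < m) w j ^+ 2))^-1 *
    expR (- (l / (1 + l * \sum_(j < m) w j ^+ 2) * c ^+ 2 / 2)))%:E.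
Proof.
move=> l0; elim: m w c => [|m IH] w c.
  by rewrite /= !big_ord0 add0r mulr0 addr0 sqrtr1 invr1 mul1r mulr1.
rewrite gauss_iterS.
set v := \sum_(j < m) w j.+1 ^+ 2.
have v0 : 0 <= v by rewrite sumr_ge0// => j _; exact: sqr_ge0.
have lv0 : 0 < 1 + l * v by rewrite ltr_pwDl// mulr_ge0.
under eq_integral => x _.
  under eq_gauss_iter => z.
    rewrite big_ord_recl /=.
    under eq_bigr do rewrite /bump /= add1n /=.
    rewrite addrAC addrC.
    over.
  rewrite (IH (fun j => w j.+1)) -/v EFinM.
  over.
rewrite ge0_integralZl//; last first.
  apply/measurable_EFinP; apply: measurableT_comp => //; apply: measurable_funN.
  apply: measurable_funM => //; apply: measurable_funM => //.
  by apply: measurable_funX; apply: measurable_funD.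
rewrite integral_normal_expR_sqr; last by rewrite divr_ge0// ltW.
rewrite -EFinM big_ord_recl /=.
under [in RHS]eq_bigr do rewrite /bump /= add1n.
rewrite -/v mulrA -invfM -sqrtrM ?(ltW lv0)//.
have E : (1 + l * v) * (1 + l / (1 + l * v) * w 0%N ^+ 2) = 1 + l * (w 0%N ^+ 2 + v).
  by field; rewrite gt_eqF.
by rewrite E -[l / (1 + l * v) / _]mulrA -invfM E.
Qed.

(** Coefficients are indexed by [nat], so that removing the first coordinate is a shift of indices.
    The linear part makes the class stable under fixing that coordinate, since cross terms become
    linear. *)
Definition quadf m (M : nat -> nat -> R) (l : nat -> R) (c : R) (z : nat -> R) : R :=
  (\sum_(i < m) \sum_(j < m) M i j * (z i * z j)) + (\sum_(i < m) l i * z i) + c.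

Lemma quadf_scons m M l c x z : (forall i j, M i j = M j i) ->
  quadf m.+1 M l c (scons x z) =
  quadf m (fun i j => M i.+1 j.+1) (fun i => l i.+1 + 2 * x * M 0%N i.+1)
    (c + M 0%N 0%N * x ^+ 2 + l 0%N * x) z.
Proof.
move=> Msym; rewrite /quadf big_ord_recl /= big_ord_recl /=.
under eq_bigr do rewrite /bump /= add1n /=.
under [X in _ + X + _ + _]eq_bigr => i _.
  rewrite big_ord_recl /= /bump /= !add1n /=.
  under eq_bigr do rewrite /bump /= add1n /=.
  over.
rewrite big_split /= [X in _ + X + _]big_ord_recl /=.
under [X in _ + (_ + X) + _]eq_bigr do rewrite /bump /= add1n /=.
under [X in _ = _ + X + _]eq_bigr do rewrite mulrDl.
rewrite [X in _ = _ + X + _]big_split /=.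
have -> : \sum_(i < m) 2 * x * M 0%N i.+1 * z i =
   \sum_(i < m) M 0%N i.+1 * (x * z i) + \sum_(i < m) M i.+1 0%N * (z i * x).
  by rewrite -big_split; apply: eq_bigr => i _; rewrite (Msym i.+1) /=; ring.
ring.
Qed.

Lemma coord_measurable_quadf m M l c : coord_measurable (quadf m M l c).
Proof.
move=> d T z mz; apply: measurable_funD => //; apply: measurable_funD.
  apply: measurable_sum => i; apply: measurable_sum => j.
  by apply: measurable_funM => //; apply: measurable_funM.
by apply: measurable_sum => i; apply: measurable_funM.
Qed.

(** Variance plus squared mean: the mean is the trace of [M] plus [c], and the variance is twice the
    squared Frobenius norm of [M] plus the squared norm of [l]. In the induction, integrating out
    all but the first coordinate leaves a nonnegative quartic in it. *)
Lemma gauss_iter_quadf m M l c : (forall i j, M i j = M j i) ->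
  gauss_iter m (fun z => (quadf m M l c z ^+ 2)%:E) =
  (2 * (\sum_(i < m) \sum_(j < m) M i j ^+ 2) + \sum_(i < m) l i ^+ 2 +
   (\sum_(i < m) M i i + c) ^+ 2)%:E.
Proof.
elim: m M l c => [|m IH] M l c Msym.
  by rewrite /= /quadf !big_ord0 mulr0 !add0r.
rewrite gauss_iterS.
under eq_integral => x _.
  under eq_gauss_iter do rewrite quadf_scons//.
  rewrite IH; last by move=> i j; exact: Msym.
  over.
set A := \sum_(i < m) \sum_(j < m) M i.+1 j.+1 ^+ 2.
set t := \sum_(i < m) M i.+1 i.+1.
set L := \sum_(i < m) l i.+1 ^+ 2.
set P := \sum_(i < m) l i.+1 * M 0%N i.+1.
set Q := \sum_(i < m) M 0%N i.+1 ^+ 2.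
have LE x : \sum_(i < m) (l i.+1 + 2 * x * M 0%N i.+1) ^+ 2 =
    L + 4 * x * P + 4 * x ^+ 2 * Q.
  rewrite /L /P /Q !mulr_sumr -!big_split; apply: eq_bigr => i _ /=; ring.
have pE x : 2 * A + \sum_(i < m) (l i.+1 + 2 * x * M 0%N i.+1) ^+ 2 +
    (t + (c + M 0%N 0%N * x ^+ 2 + l 0%N * x)) ^+ 2 =
  (2 * A + L + (t + c) ^+ 2) + (4 * P + 2 * (t + c) * l 0%N) * x +
  (4 * Q + l 0%N ^+ 2 + 2 * (t + c) * M 0%N 0%N) * x ^+ 2 +
  (2 * M 0%N 0%N * l 0%N) * x ^+ 3 + (M 0%N 0%N ^+ 2) * x ^+ 4.
  by rewrite LE; ring.
under eq_integral do rewrite pE.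
rewrite ge0_integral_normal_quartic; last first.
  move=> x; rewrite -pE addr_ge0 ?sqr_ge0// addr_ge0//.
    by rewrite mulr_ge0// sumr_ge0// => i _; rewrite sumr_ge0// => j _; exact: sqr_ge0.
  by rewrite sumr_ge0// => i _; exact: sqr_ge0.
congr EFin; rewrite !big_ord_recl /=.
under eq_bigr do rewrite /bump /= add1n.
rewrite -/Q.
under [X in _ = 2 * (_ + X) + _ + _]eq_bigr => i _.
  rewrite big_ord_recl /= /bump /= !add1n /=.
  under eq_bigr do rewrite /bump /= add1n /=.
  rewrite (Msym i.+1).
  over.
rewrite big_split /= -/A -/Q.
under [X in _ = _ + (_ + X) + _]eq_bigr do rewrite /bump /= add1n.
under [X in _ = _ + _ + (_ + X + _) ^+ _]eq_bigr do rewrite /bump /= add1n.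
rewrite -/L -/t; ring.
Qed.

Lemma coord_measurable_lin m (w : nat -> R) : coord_measurable (fun z => \sum_(j < m) w j * z j).
Proof.
by move=> d T z mz; apply: measurable_sum => i; apply: measurable_funM.
Qed.

Lemma gauss_iter_lin_sqr m (w : nat -> R) :
  gauss_iter m (fun z => ((\sum_(j < m) w j * z j) ^+ 2)%:E) =
  (\sum_(j < m) w j ^+ 2)%:E.
Proof.
have := @gauss_iter_quadf m (fun _ _ => 0) w 0 (fun _ _ => erefl).
rewrite big1 ?mulr0 ?add0r; last first.
  by move=> i _; rewrite big1// => j _; rewrite expr0n.
rewrite big1_eq addr0 expr0n addr0 => <-.
apply: eq_gauss_iter => z; rewrite /quadf addr0 [X in _ = ((X + _) ^+ 2)%:E]big1 ?add0r// => i _.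
by rewrite big1// => j _; rewrite mul0r.
Qed.

(* A majorant of the indicator of [|x - c| <= r] whose expectation at a linear
   form of the noise is explicit, so that the law of the form is not needed. *)
Definition bump_at (c r x : R) : R := 2 * expR (- (r ^- 2 * (x - c) ^+ 2 / 2)).

Lemma bump_at_ge0 c r x : 0 <= bump_at c r x.
Proof. by rewrite mulr_ge0// expR_ge0. Qed.

(** The factor 2 in [bump_at] suffices because exp (- 1/2) >= 1 - 1/2. *)
Lemma bump_at_ge1 c r x : 0 < r -> `|x - c| <= r -> 1 <= bump_at c r x.
Proof.
move=> r0 xc; rewrite /bump_at expRN ler_pdivlMr ?expR_gt0// mul1r.
have h : r ^- 2 * (x - c) ^+ 2 / 2 <= 2^-1.
  rewrite ler_piMl// mulrC ler_pdivrMr ?exprn_gt0// mul1r.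
  by rewrite -real_normK ?num_real// lerXn2r// ?nnegrE// ltW.
apply: (le_trans (y := expR 2^-1)); first by rewrite ler_expR.
have e1 : expR (- 2^-1) >= 2^-1 :> R.
  by apply: le_trans (expR_ge1Dx _); lra.
move: e1; rewrite expRN => e1.
by rewrite -[leLHS]invrK -[leRHS]invrK lef_pV2// posrE ?invr_gt0 ?expR_gt0.
Qed.

Lemma measurable_bump_at c r : measurable_fun [set: R] (bump_at c r).
Proof.
apply: measurable_funM => //; apply: measurableT_comp => //.
apply: measurable_funN; apply: measurable_funM => //.
apply: measurable_funM => //; apply: measurable_funX.
exact: measurable_funB.
Qed.

(** With [s = r^-1] the expectation is at most 2 / sqrt (1 + s^2), and sqrt (1 + s^2) >= s. *)
Lemma gauss_iter_bump_at m (w : nat -> R) c r : 0 < r ->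
  \sum_(j < m) w j ^+ 2 = 1 ->
  (gauss_iter m (fun z => (bump_at c r (\sum_(j < m) w j * z j))%:E) <= (2 * r)%:E)%E.
Proof.
move=> r0 w1; rewrite /bump_at gauss_iterZl//; last first.
  move=> d T z mz; apply: measurableT_comp => //; apply: measurable_funN.
  apply: measurable_funM => //; apply: measurable_funM => //.
  by apply: measurable_funX; apply: measurable_funB => //; exact: coord_measurable_lin.
rewrite gauss_iter_expR_sqr ?invr_ge0 ?exprn_ge0 ?(ltW r0)// w1 mulr1.
rewrite -EFinM lee_fin.
set s := r^-1; have s0 : 0 < s by rewrite invr_gt0.
have -> : r ^- 2 = s ^+ 2 by rewrite exprVn.
rewrite ler_wpM2l// -[leRHS]mulr1 ler_pM ?invr_ge0 ?sqrtr_ge0 ?expR_ge0//.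
  rewrite -[leRHS]invrK lef_pV2 ?posrE ?invr_gt0 ?sqrtr_gt0//; last first.
    by rewrite ltr_pwDl// sqr_ge0.
  rewrite -[leLHS](@ger0_norm R) ?(ltW s0)// -sqrtr_sqr ler_sqrt ?lerDr//.
  by rewrite addr_ge0// sqr_ge0.
rewrite -[leRHS]expR0 ler_expR oppr_le0 divr_ge0// mulr_ge0 ?sqr_ge0//.
by rewrite divr_ge0 ?addr_ge0 ?sqr_ge0.
Qed.
End gauss_iter.

(** * The adaptive soft threshold *)

(** At [x = 0] the quotient is 0 by the convention on division, and the leading factor makes the
    value 0. *)
Definition soft {R : realType} (b x : R) : R := x * Num.max 0 (1 - b ^+ 2 / x ^+ 2).

Section soft.
Context {R : realType}.
Implicit Types (b x y t d : R).

Lemma softN b x : soft b (- x) = - soft b x.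
Proof. by rewrite /soft sqrrN mulNr. Qed.

Lemma soft_pos b x : 0 <= b -> 0 < x ->
  soft b x = if b <= x then x - b ^+ 2 / x else 0.
Proof.
move=> b0 x0; rewrite /soft.
have xn0 : x != 0 by rewrite gt_eqF.
have E : 1 - b ^+ 2 / x ^+ 2 = (x - b) * (x + b) / x ^+ 2 by field.
case: ifPn => [bx|]; last rewrite -ltNge => xb.
  rewrite max_r; first by field.
  by rewrite E divr_ge0 ?sqr_ge0// mulr_ge0 ?subr_ge0// addr_ge0// ltW.
rewrite max_l ?mulr0// E mulr_le0_ge0 ?invr_ge0 ?sqr_ge0//.
by rewrite mulr_le0_ge0 ?subr_le0 ?(ltW xb)// addr_ge0// ltW.
Qed.

Lemma soft0 b : soft b 0 = 0.
Proof. by rewrite /soft mul0r. Qed.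

Lemma soft_ge0 b x : 0 <= x -> 0 <= soft b x.
Proof. by move=> x0; rewrite mulr_ge0// le_max lexx. Qed.

Lemma soft_le0 b x : x <= 0 -> soft b x <= 0.
Proof. by move=> x0; rewrite -oppr_ge0 -softN soft_ge0// oppr_ge0. Qed.

(** Where [soft b] is positive it equals x - b^2 / x, and the subtracted term decreases in x. *)
Lemma soft_expand b x y : 0 <= b -> x <= y -> 0 < soft b x ->
  y - x <= soft b y - soft b x.
Proof.
move=> b0 xy sx.
have x0 : 0 < x by rewrite ltNge; apply/negP => /(soft_le0 b); rewrite leNgt sx.
have y0 : 0 < y by apply: lt_le_trans xy.
move: sx; rewrite !soft_pos//; case: ifPn => [bx _|_]; last by rewrite ltxx.
rewrite (le_trans bx xy).
suff : b ^+ 2 / y <= b ^+ 2 / x by lra.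
by rewrite ler_wpM2l ?sqr_ge0// lef_pV2.
Qed.

Lemma soft_homo b : 0 <= b -> {homo soft b : x y / x <= y}.
Proof.
move=> b0 x y xy; have [x0|x0] := leP 0 x; last first.
  have [y0|y0] := leP 0 y.
    by rewrite (le_trans (soft_le0 _ _ (ltW x0)))// soft_ge0.
  have := soft_le0 b _ (ltW y0); rewrite le_eqVlt => /predU1P[->|sy].
    by rewrite soft_le0// ltW.
  have := soft_expand b (- y) (- x) b0.
  rewrite lerN2 !softN oppr_gt0 => /(_ xy sy).
  by move=> h; lra.
have := soft_ge0 b _ x0; rewrite le_eqVlt => /predU1P[<-|sx].
  by rewrite soft_ge0// (le_trans x0).
have := soft_expand b _ _ b0 xy sx; lra.
Qed.

(** For x > 0 the displacement is b^2 / x when x >= b, and x itself when x < b. *)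
Lemma soft_shrink b x : 0 <= b -> `|soft b x - x| <= b.
Proof.
move=> b0; wlog x0 : x / 0 <= x => [H|].
  have [/H//|x0] := leP 0 x.
  have -> : soft b x - x = - (soft b (- x) - (- x)) by rewrite softN; ring.
  by rewrite normrN; apply: H; rewrite oppr_ge0 ltW.
move: x0; rewrite le_eqVlt => /predU1P[<-|x0]; first by rewrite soft0 subrr normr0.
rewrite soft_pos//; case: ifPn => [bx|]; last rewrite -ltNge => xb.
  rewrite addrAC subrr add0r normrN ger0_norm; last by rewrite divr_ge0 ?sqr_ge0// ltW.
  by rewrite ler_pdivrMr// expr2 ler_wpM2l.
by rewrite sub0r normrN gtr0_norm// ltW.
Qed.

Lemma soft_lip b c x : 0 <= b -> 0 <= c -> `|soft b x - soft c x| <= 2 * `|b - c|.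
Proof.
wlog bc : b c / b <= c => [H b0 c0|b0 c0].
  by have [/H|/ltW/H] := leP b c; [exact|rewrite distrC [`|b - c|]distrC; exact].
wlog x0 : x / 0 <= x => [H|].
  have [/H//|x0] := leP 0 x.
  have -> : soft b x - soft c x = - (soft b (- x) - soft c (- x)).
    by rewrite !softN; ring.
  by rewrite normrN H// oppr_ge0 ltW.
move: x0; rewrite le_eqVlt => /predU1P[<-|x0].
  by rewrite !soft0 subrr normr0 mulr_ge0.
rewrite !soft_pos// [`|b - c|]distrC [X in _ <= 2 * X]ger0_norm ?subr_ge0//.
have xn0 : x != 0 by rewrite gt_eqF.
(* If [c <= x], the difference is (c - b)(c + b) / x with c + b <= 2 x. If [b <= x < c], it is (x -
   b)(x + b) / x, at most 2 (x - b). If [x < b], both values vanish. *)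
case: (leP c x) => [cx|xc].
  rewrite (le_trans bc cx).
  have -> : x - b ^+ 2 / x - (x - c ^+ 2 / x) = (c - b) * (c + b) / x by field.
  rewrite ger0_norm; last by rewrite divr_ge0 ?mulr_ge0 ?subr_ge0 ?addr_ge0// ltW.
  rewrite ler_pdivrMr// mulrAC [leRHS]mulrC ler_wpM2l ?subr_ge0//; lra.
case: (leP b x) => [bx|xb]; last by rewrite subrr normr0 mulr_ge0// subr_ge0.
have -> : x - b ^+ 2 / x - 0 = (x - b) * (x + b) / x by field.
rewrite ger0_norm; last by rewrite divr_ge0 ?mulr_ge0 ?subr_ge0 ?addr_ge0// ltW.
rewrite ler_pdivrMr// (le_trans (y := (x - b) * (2 * x)))//.
  by rewrite ler_wpM2l ?subr_ge0//; lra.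
by rewrite mulrCA -mulrA ler_wpM2l// ler_wpM2r ?(ltW x0)//; lra.
Qed.

(** Any point of the set can serve as centre: by [soft_expand], two points of it are no further
    apart than their values. The bound [0 <= p] keeps the set away from the zero set of [soft b]. *)
Lemma soft_positive_window b p q : 0 <= b -> 0 <= p -> p <= q ->
  exists c, forall x, p < soft b x -> soft b x <= q -> `|x - c| <= q - p.
Proof.
move=> b0 p0 pq.
have [[x0 [px0 qx0]]|H] := pselect (exists x0, p < soft b x0 /\ soft b x0 <= q); last first.
  by exists 0 => x px qx; exfalso; apply: H; exists x.
exists x0 => x px qx; have [xx|xx] := leP x0 x.
  rewrite ger0_norm ?subr_ge0//.
  have := soft_expand b _ _ b0 xx (le_lt_trans p0 px0); lra.
rewrite ltr0_norm ?subr_lt0//.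
have := soft_expand b _ _ b0 (ltW xx) (le_lt_trans p0 px); lra.
Qed.

(** By monotonicity, soft b x < v <= soft b (y + d) forces x <= y + d. Applied both ways, any two
    crossing points are within [d]. This works for every level [v], including 0. *)
Lemma soft_crossing b v d : 0 <= b -> 0 <= d ->
  exists c, forall x, soft b x < v -> v <= soft b (x + d) -> `|x - c| <= d.
Proof.
move=> b0 d0.
have [[x0 [h1 h2]]|H] := pselect (exists x0, soft b x0 < v /\ v <= soft b (x0 + d)); last first.
  by exists 0 => x h1 h2; exfalso; apply: H; exists x.
have lt x y : soft b x < v -> v <= soft b (y + d) -> x <= y + d.
  move=> xv vy; rewrite leNgt; apply/negP => /ltW/(soft_homo b b0) h.
  by have := lt_le_trans xv (le_trans vy h); rewrite ltxx.
exists x0 => x k1 k2; rewrite ler_norml.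
have := lt _ _ h1 k2; have := lt _ _ k1 h2; lra.
Qed.

(** * Pathwise comparison of the two coverage events *)

Section perturbation.
Variables (b al rho del : R).
Hypotheses (b0 : 0 <= b) (al0 : 0 <= al) (del0 : 0 <= del).
Hypothesis small : (2 * b + al) * rho <= del.

(** The Lipschitz bound costs 2 b |d - 1| for the threshold, and the radius moves by al |d - 1|;
    this is the origin of the left side of [small]. *)
Let pert d x : 0 <= d -> `|d - 1| <= rho ->
  `|soft (d * b) x - soft b x| + `|d * al - al| <= del.
Proof.
move=> d0 dr; apply: le_trans small; rewrite mulrDl; apply: lerD.
  apply: (le_trans (soft_lip _ _ _ (mulr_ge0 d0 b0) b0)).
  rewrite -mulrA ler_wpM2l// -[X in _ - X]mul1r -mulrBl normrM (ger0_norm b0).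
  by rewrite mulrC ler_wpM2l.
by rewrite -[X in _ - X]mul1r -mulrBl normrM (ger0_norm al0) mulrC ler_wpM2l.
Qed.

Let pert_le d x : 0 <= d -> `|d - 1| <= rho ->
  [/\ soft (d * b) x + d * al <= soft b x + al + del,
      soft b x + al - del <= soft (d * b) x + d * al,
      soft (d * b) x - d * al <= soft b x - al + del &
      soft b x - al - del <= soft (d * b) x - d * al].
Proof.
move=> d0 dr; have := pert d x d0 dr.
have := ler_norm (soft (d * b) x - soft b x).
have := ler_norm (d * al - al).
have := ler_norm (- (soft (d * b) x - soft b x)).
have := ler_norm (- (d * al - al)).
rewrite !normrN => *; split; lra.
Qed.

(** At [t' = t + 2 * del] the feasible event puts soft b (t' + x) between t - al + del and t + al +
    3 del. If the known-variance event fails at [t] from below, the step 2 del crosses the level t -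
    al; if it fails from above, soft b (t + x) is in a window of width 3 del above t + al >= 0.
    Without the shift, the window below t - al could contain 0, which [soft b] takes on a long
    interval. *)
Let to_feasible0 t : 0 <= t -> exists t' c1 c2, forall x d, 0 <= d -> `|d - 1| <= rho ->
  `|soft (d * b) (t' + x) - t'| <= d * al ->
  [\/ `|soft b (t + x) - t| <= al, `|x - c1| <= 3 * del | `|x - c2| <= 3 * del].
Proof.
move: (al0) (del0) => ? ? t0; exists (t + 2 * del).
have p0 : 0 <= t + al by lra.
have pq : t + al <= t + al + 3 * del by lra.
have d20 : 0 <= 2 * del by lra.
have [c1 H1] := soft_positive_window b _ _ b0 p0 pq.
have [c2 H2] := soft_crossing b (t - al) (2 * del) b0 d20.
exists (c1 - t), (c2 - t) => x d d0 dr; rewrite ler_norml => /andP[E1 E2].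
have E : t + 2 * del + x = t + x + 2 * del by ring.
have [P1 P2 P3 P4] := pert_le d (t + 2 * del + x) d0 dr.
rewrite E in E1 E2 P1 P2 P3 P4.
have mono : soft b (t + x) <= soft b (t + x + 2 * del) by apply: soft_homo => //; lra.
have [lo|lo] := ltP (soft b (t + x)) (t - al).
  apply: Or33; have -> : x - (c2 - t) = t + x - c2 by ring.
  apply: (le_trans (H2 _ lo _)); lra.
have [up|up] := ltP (t + al) (soft b (t + x)).
  apply: Or32; have -> : x - (c1 - t) = t + x - c1 by ring.
  apply: (le_trans (H1 _ up _)); lra.
by apply: Or31; rewrite ler_norml; apply/andP; split; lra.
Qed.

(** The same shift is used, but the target interval shrinks by [del] at each end ([fin]) to absorb
    the perturbation. The lower end of the known-variance event at [t'] is t - al + 2 del, still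
    above the shrunken lower end, so failure from below is again a crossing. *)
Let of_feasible0 t : 0 <= t -> exists t' c1 c2, forall x d, 0 <= d -> `|d - 1| <= rho ->
  `|soft b (t' + x) - t'| <= al ->
  [\/ `|soft (d * b) (t + x) - t| <= d * al, `|x - c1| <= 3 * del | `|x - c2| <= 3 * del].
Proof.
move: (al0) (del0) => ? ? t0; exists (t + 2 * del).
have d20 : 0 <= 2 * del by lra.
have [c2 H2] := soft_crossing b (t - al + del) (2 * del) b0 d20.
have fin x d : 0 <= d -> `|d - 1| <= rho -> t - al + del <= soft b (t + x) ->
    soft b (t + x) <= t + al - del -> `|soft (d * b) (t + x) - t| <= d * al.
  move=> d0 dr; have [P1 P2 P3 P4] := pert_le d (t + x) d0 dr.
  by move=> *; rewrite ler_norml; apply/andP; split; lra.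
have low x : t - al + 2 * del <= soft b (t + x + 2 * del) ->
    soft b (t + x) < t - al + del -> `|x - (c2 - t)| <= 3 * del.
  move=> h lo; have -> : x - (c2 - t) = t + x - c2 by ring.
  apply: (le_trans (H2 _ lo _)); lra.
have [p0|p0] := leP 0 (t + al - del).
- have pq : t + al - del <= t + al + 2 * del by lra.
  have [c1 H1] := soft_positive_window b _ _ b0 p0 pq.
  exists (c1 - t), (c2 - t) => x d d0 dr; rewrite ler_norml => /andP[E1 E2].
  have E : t + 2 * del + x = t + x + 2 * del by ring.
  rewrite E in E1 E2.
  have mono : soft b (t + x) <= soft b (t + x + 2 * del) by apply: soft_homo => //; lra.
  have [lo|lo] := ltP (soft b (t + x)) (t - al + del).
    by apply: Or33; apply: low => //; lra.
  have [up|up] := ltP (t + al - del) (soft b (t + x)).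
    apply: Or32; have -> : x - (c1 - t) = t + x - c1 by ring.
    apply: (le_trans (H1 _ up _)); lra.
  by apply: Or31; exact: fin.
(* Here t + al < del, so the event at [t'] already confines soft b (t' + x) to (0, 3 del]; the
   window is taken at t' + x rather than t + x. *)
- have d30 : 0 <= 3 * del by lra.
  have [c1 H1] := soft_positive_window b _ _ b0 (lexx 0) d30.
  exists (c1 - t - 2 * del), (c2 - t) => x d d0 dr; rewrite ler_norml => /andP[E1 E2].
  apply: Or32; have -> : x - (c1 - t - 2 * del) = t + 2 * del + x - c1 by ring.
  apply: (le_trans (H1 _ _ _)); lra.
Qed.

Let flip c y s : `|soft c (- y) - s| = `|soft c y - - s|.
Proof. by rewrite softN -opprD normrN opprK. Qed.

(** The witnesses are chosen before [x] and [d], so the exceptional set consists of two fixed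
    intervals for the linear form, whatever its dependence on the random [d]. Negative [t] follows
    by oddness, reflecting [x], [t'] and both centres. *)
Lemma coverage_to_feasible t : exists t' c1 c2, forall x d, 0 <= d -> `|d - 1| <= rho ->
  `|soft (d * b) (t' + x) - t'| <= d * al ->
  [\/ `|soft b (t + x) - t| <= al, `|x - c1| <= 3 * del | `|x - c2| <= 3 * del].
Proof.
have [t0|t0] := leP 0 t; first exact: to_feasible0.
have [|t' [c1 [c2 H]]] := to_feasible0 (- t); first lra.
exists (- t'), (- c1), (- c2) => x d d0 dr h.
have sgn c : `|- x - c| = `|x - - c| by rewrite -normrN opprD !opprK.
have := H (- x) d d0 dr; rewrite !sgn; case => [|h1|h1|h1].
- by rewrite (_ : t' - x = - (- t' + x)) ?flip//; ring.
- by apply: Or31; rewrite (_ : t + x = - (- t - x)) ?flip//; ring.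
- exact: Or32.
- exact: Or33.
Qed.

Lemma coverage_of_feasible t : exists t' c1 c2, forall x d, 0 <= d -> `|d - 1| <= rho ->
  `|soft b (t' + x) - t'| <= al ->
  [\/ `|soft (d * b) (t + x) - t| <= d * al, `|x - c1| <= 3 * del | `|x - c2| <= 3 * del].
Proof.
have [t0|t0] := leP 0 t; first exact: of_feasible0.
have [|t' [c1 [c2 H]]] := of_feasible0 (- t); first lra.
exists (- t'), (- c1), (- c2) => x d d0 dr h.
have sgn c : `|- x - c| = `|x - - c| by rewrite -normrN opprD !opprK.
have := H (- x) d d0 dr; rewrite !sgn; case => [|h1|h1|h1].
- by rewrite (_ : t' - x = - (- t' + x)) ?flip//; ring.
- by apply: Or31; rewrite (_ : t + x = - (- t - x)) ?flip//; ring.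
- exact: Or32.
- exact: Or33.
Qed.
End perturbation.

(** The error is at most d b + g, and g <= 2 d g because d >= 1/2. *)
Lemma soft_covers b al d x t g : 0 <= b -> 1 / 2 <= d -> 0 <= g ->
  b + 2 * g <= al -> `|x| <= g -> `|soft (d * b) (t + x) - t| <= d * al.
Proof.
move=> b0 d0 g0 al0 xg.
have db0 : 0 <= d * b by rewrite mulr_ge0//; lra.
have -> : soft (d * b) (t + x) - t = soft (d * b) (t + x) - (t + x) + x by ring.
apply: (le_trans (ler_normD _ _)); apply: (le_trans (lerD (soft_shrink _ _ db0) xg)).
apply: (@le_trans _ _ (d * (b + 2 * g))); last by rewrite ler_wpM2l//; lra.
rewrite mulrDr lerD2l mulrA -[leLHS]mul1r ler_wpM2r//; lra.
Qed.
End soft.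

(** * Comparison of the two coverage probabilities *)

Section measurability.
Context {R : realType} {d} {T : measurableType d}.
Implicit Types f g : T -> R.

Lemma measurable_inv_sqr f : measurable_fun setT f ->
  measurable_fun setT (fun t => (f t ^+ 2)^-1).
Proof.
move=> mf.
have -> : (fun t => (f t ^+ 2)^-1) = (@powR R ^~ (-1)) \o (fun t => f t ^+ 2).
  by apply/funext => t /=; rewrite powR_inv1// sqr_ge0.
apply: measurableT_comp; first exact: measurable_powR.
exact: measurable_funX.
Qed.

Lemma measurable_sqrtr f : measurable_fun setT f ->
  measurable_fun setT (fun t => Num.sqrt (f t)).
Proof.
move=> mf; apply: (measurableT_comp (f := @Num.sqrt R)) => //.
apply: continuous_measurable_fun; exact: sqrt_continuous.
Qed.

Lemma measurable_soft f g : measurable_fun setT f -> measurable_fun setT g ->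
  measurable_fun setT (fun t => soft (f t) (g t)).
Proof.
move=> mf mg; apply: measurable_funM => //; apply: measurable_maxr => //.
apply: measurable_funB => //; apply: measurable_funM; first exact: measurable_funX.
exact: measurable_inv_sqr.
Qed.

Lemma measurable_ler_indic f g : measurable_fun setT f -> measurable_fun setT g ->
  measurable_fun setT (fun t => (f t <= g t)%R%:R : R).
Proof.
move=> mf mg.
have -> : (fun t => (f t <= g t)%R%:R : R) = (fun t => if f t <= g t then 1 else 0).
  by apply/funext => t; case: ifP.
by apply: measurable_fun_ifT => //; exact: measurable_fun_ler.
Qed.
End measurability.

Section coverage.
Context {R : realType}.
Variables (n : nat) (w : nat -> R) (D : (nat -> R) -> R) (v : R).
Hypothesis w1 : \sum_(j < n) w j ^+ 2 = 1.
Hypothesis D0 : forall z, 0 <= D z.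
Hypothesis mD : coord_measurable D.
Hypothesis Dv : (gauss_iter n (fun z => ((D z ^+ 2 - 1) ^+ 2)%:E) <= v%:E)%E.

Let G (z : nat -> R) := \sum_(j < n) w j * z j.

Definition cov_known (b al t : R) : \bar R :=
  gauss_iter n (fun z => (`|soft b (t + G z) - t| <= al)%R%:R%:E).

Definition cov_feasible (b al t : R) : \bar R :=
  gauss_iter n (fun z => (`|soft (D z * b) (t + G z) - t| <= D z * al)%R%:R%:E).

Let mG : coord_measurable G. Proof. exact: coord_measurable_lin. Qed.

Let msf_known b al t : coord_measurable (fun z => (`|soft b (t + G z) - t| <= al)%R%:R).
Proof.
move=> d T z mz; apply: measurable_ler_indic => //.
apply: measurableT_comp => //; apply: measurable_funB => //.
by apply: measurable_soft => //; apply: measurable_funD => //; exact: mG.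
Qed.

Let msf_feasible b al t :
  coord_measurable (fun z => (`|soft (D z * b) (t + G z) - t| <= D z * al)%R%:R).
Proof.
move=> d T z mz.
have mDz : measurable_fun setT (fun x => D (z x)) by exact: mD.
apply: measurable_ler_indic; last exact: measurable_funM.
apply: measurableT_comp => //; apply: measurable_funB => //.
apply: measurable_soft; first exact: measurable_funM.
by apply: measurable_funD => //; exact: mG.
Qed.

Let mdev c : coord_measurable (fun z => c * (D z ^+ 2 - 1) ^+ 2).
Proof.
move=> d T z mz; apply: measurable_funM => //; apply: measurable_funX.
by apply: measurable_funB => //; apply: measurable_funX; exact: mD.
Qed.

Let mdev1 : coord_measurable (fun z => (D z ^+ 2 - 1) ^+ 2).
Proof. by move=> d T z mz; have := mdev 1 _ _ z mz; under eq_fun do rewrite mul1r. Qed.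

Let mbump c r : coord_measurable (fun z => bump_at c r (G z)).
Proof.
move=> d T z mz; apply: measurableT_comp; last exact: mG.
exact: measurable_bump_at.
Qed.

Let dev_bound c : 0 <= c ->
  (gauss_iter n (fun z => (c * (D z ^+ 2 - 1) ^+ 2)%:E) <= (c * v)%:E)%E.
Proof.
move=> c0; rewrite gauss_iterZl//; last by move=> z; exact: sqr_ge0.
by rewrite EFinM lee_wpmul2l// lee_fin.
Qed.

(** Transfers the moment bound on [D z ^+ 2 - 1] to [D z - 1]. *)
Lemma dist1_le_sqr (x : R) : 0 <= x -> `|x - 1| <= `|x ^+ 2 - 1|.
Proof.
move=> x0; have -> : x ^+ 2 - 1 = (x - 1) * (x + 1) by ring.
by rewrite normrM ler_peMr// ger0_norm ?addr_ge0// lerDr.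
Qed.

Let far_dev rho z : 0 < rho -> ~~ (`|D z - 1| <= rho) ->
  1 <= rho ^- 2 * (D z ^+ 2 - 1) ^+ 2.
Proof.
move=> rho0; rewrite -ltNge => far.
rewrite mulrC ler_pdivlMr ?exprn_gt0// mul1r -[leRHS]real_normK ?num_real//.
rewrite lerXn2r ?nnegrE ?(ltW rho0)//.
by rewrite (le_trans (ltW far))// dist1_le_sqr.
Qed.

(** The indicator of [A] is bounded pointwise by that of [B], plus one bump per interval, plus a
    Chebyshev term for |D - 1| > rho. Their expectations add up without any knowledge of the joint
    law: each bump costs 2 r, and the last term costs rho^-2 v. *)
Lemma gauss_iter_le_near (A B : (nat -> R) -> bool) rho r c1 c2 :
  0 < rho -> 0 < r -> coord_measurable (fun z => (A z)%:R) -> coord_measurable (fun z => (B z)%:R) ->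
  (forall z, `|D z - 1| <= rho -> A z -> [\/ B z, `|G z - c1| <= r | `|G z - c2| <= r]) ->
  (gauss_iter n (fun z => (A z)%:R%:E) <=
   gauss_iter n (fun z => (B z)%:R%:E) + (4 * r + rho ^- 2 * v)%:E)%E.
Proof.
move=> rho0 r0 mA mB AB.
have rho20 : 0 <= rho ^- 2 by rewrite invr_ge0 exprn_ge0// ltW.
pose b1 z := bump_at c1 r (G z); pose b2 z := bump_at c2 r (G z).
pose q z := rho ^- 2 * (D z ^+ 2 - 1) ^+ 2.
have b10 z : 0 <= b1 z by exact: bump_at_ge0.
have b20 z : 0 <= b2 z by exact: bump_at_ge0.
have q0 z : 0 <= q z by rewrite mulr_ge0// sqr_ge0.
have msfD f g : coord_measurable f -> coord_measurable g -> coord_measurable (fun z => f z + g z :> R).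
  by move=> mf mg d T z mz; apply: measurable_funD; [exact: mf|exact: mg].
have mb1 : coord_measurable b1 by exact: mbump.
have mb2 : coord_measurable b2 by exact: mbump.
have mq : coord_measurable q by exact: mdev.
apply: (@le_trans _ _ (gauss_iter n (fun z => ((B z)%:R + (b1 z + (b2 z + q z)))%:E))).
  apply: le_gauss_iter => //; first by apply: (msfD _ _ mB (msfD _ _ mb1 (msfD _ _ mb2 mq))).
  move=> z; have [Az|] := boolP (A z); last by rewrite !addr_ge0.
  have [near|far] := boolP (`|D z - 1| <= rho); last first.
    by rewrite !addrA ler_wpDl ?addr_ge0//; exact: far_dev.
  case: (AB z near Az) => [->|h|h]; first by rewrite lerDl !addr_ge0.
  - by rewrite ler_wpDl// ler_wpDr ?addr_ge0//; exact: bump_at_ge1.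
  - by rewrite ler_wpDl// ler_wpDl// ler_wpDr//; exact: bump_at_ge1.
rewrite gauss_iterD//; [|by move=> z; rewrite !addr_ge0|exact: (msfD _ _ mb1 (msfD _ _ mb2 mq))].
rewrite leeD2l// gauss_iterD//; [|by move=> z; rewrite !addr_ge0|exact: msfD].
rewrite gauss_iterD//.
have -> : (4 * r + rho ^- 2 * v)%:E = ((2 * r)%:E + ((2 * r)%:E + (rho ^- 2 * v)%:E))%E.
  by rewrite -!EFinD; congr EFin; ring.
by rewrite leeD ?leeD//; [exact: gauss_iter_bump_at|exact: gauss_iter_bump_at|exact: dev_bound].
Qed.

Section bounds.
Variables (b al : R).
Hypotheses (b0 : 0 <= b) (al0 : 0 <= al).

Lemma cov_feasible_le rho del t : 0 < rho -> 0 < del -> (2 * b + al) * rho <= del ->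
  exists t', (cov_feasible b al t' <= cov_known b al t + (12 * del + rho ^- 2 * v)%:E)%E.
Proof.
move=> rho0 del0 small.
have [t' [c1 [c2 H]]] := coverage_to_feasible b al rho del b0 al0 (ltW del0) small t.
exists t'; have -> : 12 * del = 4 * (3 * del) by ring.
apply: (@gauss_iter_le_near _ _ rho (3 * del) c1 c2) => //; first by rewrite mulr_gt0.
by move=> z near Az; exact: (H (G z) (D z)).
Qed.

Lemma cov_known_le rho del t : 0 < rho -> 0 < del -> (2 * b + al) * rho <= del ->
  exists t', (cov_known b al t' <= cov_feasible b al t + (12 * del + rho ^- 2 * v)%:E)%E.
Proof.
move=> rho0 del0 small.
have [t' [c1 [c2 H]]] := coverage_of_feasible b al rho del b0 al0 (ltW del0) small t.
exists t'; have -> : 12 * del = 4 * (3 * del) by ring.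
apply: (@gauss_iter_le_near _ _ rho (3 * del) c1 c2) => //; first by rewrite mulr_gt0.
by move=> z near Az; exact: (H (G z) (D z)).
Qed.

Let mG2 g : coord_measurable (fun z => g ^- 2 * G z ^+ 2).
Proof.
move=> d T z mz; apply: measurable_funM => //; apply: measurable_funX; exact: mG.
Qed.

Let G2_bound g :
  gauss_iter n (fun z => (g ^- 2 * G z ^+ 2)%:E) = (g ^- 2)%:E.
Proof.
rewrite gauss_iterZl ?invr_ge0 ?exprn_even_ge0//; last 2 first.
- by move=> z; exact: sqr_ge0.
- by move=> d T z mz; apply: measurable_funX; exact: mG.
by rewrite gauss_iter_lin_sqr w1 mule1.
Qed.

Let far_G g z : 0 < g -> ~~ (`|G z| <= g) -> 1 <= g ^- 2 * G z ^+ 2.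
Proof.
move=> g0; rewrite -ltNge => far.
rewrite mulrC ler_pdivlMr ?exprn_gt0// mul1r -[leRHS]real_normK ?num_real//.
by rewrite lerXn2r ?nnegrE ?(ltW g0)// ltW.
Qed.

(** Two Chebyshev bounds: |G| > g costs g^-2 because G has second moment 1, and |D - 1| > 1/2 costs
    4 v. Outside both events D >= 1/2, and [soft_covers] applies. *)
Lemma cov_feasible_ge g t : 0 < g -> b + 2 * g <= al ->
  (1 <= cov_feasible b al t + (g ^- 2 + 4 * v)%:E)%E.
Proof.
move=> g0 gal.
have g20 : 0 <= g ^- 2 by rewrite invr_ge0 exprn_ge0// ltW.
pose q z := g ^- 2 * G z ^+ 2; pose p z := 4 * (D z ^+ 2 - 1) ^+ 2.
have q0 z : 0 <= q z by rewrite mulr_ge0// sqr_ge0.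
have p0 z : 0 <= p z by rewrite mulr_ge0// sqr_ge0.
have mqp : coord_measurable (fun z => q z + p z).
  by move=> d T z mz; apply: measurable_funD; [exact: mG2|exact: mdev].
rewrite -(gauss_iter_cst n 1).
apply: (@le_trans _ _ (gauss_iter n (fun z =>
    ((`|soft (D z * b) (t + G z) - t| <= D z * al)%R%:R + (q z + p z))%:E))).
  apply: le_gauss_iter => //.
    move=> d T z mz; apply: measurable_funD; last exact: mqp.
    exact: msf_feasible.
  move=> z; have [near|far] := boolP (`|D z - 1| <= 2^-1); last first.
    rewrite addrA ler_wpDl ?addr_ge0//.
    by have := far_dev _ z _ far; rewrite exprVn invrK expr2 -natrM; apply.
  have [Gg|Gg] := boolP (`|G z| <= g); last first.
    by rewrite addrCA ler_wpDr ?addr_ge0//; exact: far_G.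
  rewrite (soft_covers b al (D z) (G z) t g)//; last exact: ltW.
    by rewrite lerDl addr_ge0.
  move: near; rewrite ler_norml => /andP[h _]; lra.
rewrite gauss_iterD//; last by move=> z; rewrite addr_ge0.
rewrite leeD2l// gauss_iterD//; [|exact: mG2|exact: mdev].
have -> : (g ^- 2 + 4 * v)%:E = ((g ^- 2)%:E + (4 * v)%:E)%E by [].
by rewrite leeD ?dev_bound// G2_bound.
Qed.

Lemma cov_known_ge g t : 0 < g -> b + 2 * g <= al ->
  (1 <= cov_known b al t + (g ^- 2)%:E)%E.
Proof.
move=> g0 gal.
have g20 : 0 <= g ^- 2 by rewrite invr_ge0 exprn_ge0// ltW.
rewrite -(gauss_iter_cst n 1) -G2_bound -gauss_iterD//; last by move=> z; rewrite mulr_ge0// sqr_ge0.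
apply: le_gauss_iter => //.
  move=> d T z mz; apply: measurable_funD; last exact: mG2.
  exact: msf_known.
move=> z; have [Gg|Gg] := boolP (`|G z| <= g); last first.
  by rewrite ler_wpDl//; exact: far_G.
have := soft_covers b al 1 (G z) t g b0 _ (ltW g0) gal Gg; rewrite !mul1r => ->.
  by rewrite lerDl mulr_ge0// sqr_ge0.
lra.
Qed.

Lemma cov_known_le1 t : (cov_known b al t <= 1)%E.
Proof.
rewrite -(gauss_iter_cst n 1); apply: le_gauss_iter => //.
by move=> z; rewrite lern1 leq_b1.
Qed.

Lemma cov_feasible_le1 t : (cov_feasible b al t <= 1)%E.
Proof.
rewrite -(gauss_iter_cst n 1); apply: le_gauss_iter => //.
by move=> z; rewrite lern1 leq_b1.
Qed.

(** If al >= b + 2 g, both coverages are close to 1 for every [t]; otherwise the perturbation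
    comparison applies. The error [e] collects the costs of both regimes. *)
Lemma inf_cov_close g del : 0 < g -> 0 < del ->
  let e := 12 * del + g ^- 2 + 4 * v + ((3 * b + 2 * g) / del) ^+ 2 * v in
  (ereal_inf (range (cov_feasible b al)) <= ereal_inf (range (cov_known b al)) + e%:E)%E /\
  (ereal_inf (range (cov_known b al)) <= ereal_inf (range (cov_feasible b al)) + e%:E)%E.
Proof.
move=> g0 del0 e.
have v0 : 0 <= v.
  rewrite -lee_fin; apply: le_trans Dv; apply: gauss_iter_ge0 => z.
  by rewrite lee_fin sqr_ge0.
have g20 : 0 <= g ^- 2 by rewrite invr_ge0 exprn_ge0// ltW.
have s0 : 0 <= ((3 * b + 2 * g) / del) ^+ 2 * v by rewrite mulr_ge0// sqr_ge0.
(* Infima are compared by bounding [f] at some point [t'] by [h] at [t]; the point may move with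
   [t]. *)
have key (f h : R -> \bar R) (c : R) : c <= e ->
    (forall t, exists t', f t' <= h t + c%:E)%E ->
    (ereal_inf (range f) <= ereal_inf (range h) + e%:E)%E.
  move=> ce fh; rewrite -leeBlDr//; apply: le_ereal_inf_tmp => _ [t _ <-].
  have [t' ft'] := fh t.
  rewrite leeBlDr//; apply: (@le_trans _ _ (f t')).
    by apply: ereal_inf_lbound; exists t'.
  by apply: (le_trans ft'); rewrite leeD2l// lee_fin.
have [big|small] := leP (b + 2 * g) al.
  split; [apply: (key _ _ (g ^- 2))|apply: (key _ _ (g ^- 2 + 4 * v))].
  - rewrite /e; lra.
  - move=> t; exists t; apply: (le_trans (cov_feasible_le1 t)); exact: cov_known_ge.
  - rewrite /e; lra.
  - move=> t; exists t; apply: (le_trans (cov_known_le1 t)); exact: cov_feasible_ge.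
(* In this regime 2 b + al <= 3 b + 2 g, so this choice satisfies the smallness condition. *)
pose rho := del / (3 * b + 2 * g).
have K0 : 0 < 3 * b + 2 * g by move: (b0) => ?; lra.
have rho0 : 0 < rho by rewrite divr_gt0.
have sm : (2 * b + al) * rho <= del.
  rewrite /rho mulrCA ler_piMr ?(ltW del0)// ler_pdivrMr// mul1r; move: (b0) => ?; lra.
have rhoE : rho ^- 2 = ((3 * b + 2 * g) / del) ^+ 2 by rewrite -exprVn invf_div.
by split; apply: (key _ _ (12 * del + rho ^- 2 * v)) => [|t];
  rewrite ?rhoE; [rewrite /e; lra| |rewrite /e; lra|];
  rewrite -rhoE; [exact: cov_feasible_le|exact: cov_known_le].
Qed.
End bounds.
End coverage.

(** * Reduction of the linear model *)

Section least_squares.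
Context {R : realType}.
Variables (n k : nat) (X : 'M[R]_(n, k)).
Hypothesis rkX : \rank X = k.

Let B : 'M[R]_(k, n) := invmx (X^T *m X) *m X^T.
Let M : 'M[R]_n := 1%:M - X *m B.

Lemma mulmx_tr_eq0 p q (A : 'M[R]_(p, q)) : A *m A^T = 0 -> A = 0.
Proof.
move=> A0; apply/matrixP => i j; rewrite [RHS]mxE.
have /eqP := congr1 (fun C : 'M[R]_(p, p) => C i i) A0; rewrite !mxE.
rewrite psumr_eq0; last by move=> l _; rewrite mxE -expr2 sqr_ge0.
by move=> /allP /(_ j (mem_index_enum j)) /=; rewrite mxE -expr2 sqrf_eq0 => /eqP.
Qed.

(** If K X'X = 0 then (K X')(K X')' = 0, hence K X' = 0, and full rank gives K = 0. *)
Lemma gram_unit : X^T *m X \in unitmx.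
Proof.
have fX : row_free X^T by rewrite /row_free mxrank_tr rkX.
rewrite -row_free_unit -kermx_eq0; set K := kermx _.
have K0 : K *m (X^T *m X) = 0 by exact: mulmx_ker.
have : K *m X^T = 0.
  apply: mulmx_tr_eq0.
  by rewrite trmx_mul trmxK mulmxA -(mulmxA K) K0 mul0mx.
by move=> h; apply/eqP; apply: (row_free_inj fX); rewrite h mul0mx.
Qed.

Let BX : B *m X = 1%:M.
Proof. by rewrite /B -mulmxA mulVmx// gram_unit. Qed.

Let BBT : B *m B^T = invmx (X^T *m X).
Proof.
rewrite /B trmx_mul trmxK trmx_inv trmx_mul trmxK -!mulmxA (mulmxA X^T).
by rewrite mulmxV ?gram_unit// mulmx1.
Qed.

Let XB_sym : (X *m B)^T = X *m B.
Proof.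
by rewrite /B !trmx_mul trmx_inv trmx_mul !trmxK mulmxA.
Qed.

Lemma resid_mx_sym : M^T = M.
Proof. by rewrite /M linearB /= trmx1 XB_sym. Qed.

Let M_idem : M *m M = M.
Proof.
have XBXB : X *m B *m (X *m B) = X *m B.
  by rewrite mulmxA -(mulmxA X B X) BX mulmx1.
by rewrite /M mulmxBl mul1mx mulmxBr mulmx1 XBXB subrr subr0.
Qed.

Let ME i l : M i l = M l i.
Proof. by rewrite -[in LHS]resid_mx_sym [LHS]mxE. Qed.

Lemma mxtrace_resid_mx : \tr M = n%:R - k%:R.
Proof. by rewrite /M linearB /= mxtrace1 mxtrace_mulC BX mxtrace1. Qed.

Lemma theta_LS_model (theta : 'cV[R]_k) s (z : 'cV[R]_n) :
  theta_LS X (X *m theta + s *: z) = theta + s *: (B *m z).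
Proof.
by rewrite /theta_LS -/B mulmxDr mulmxA BX mul1mx -scalemxAr.
Qed.

(** The residual sum of squares for unit noise, written as a double sum to match [quadf]. *)
Definition resid_form (z : 'cV[R]_n) : R := \sum_i \sum_j M i j * (z i 0 * z j 0).

Lemma resid_formE z : resid_form z = \sum_i ((M *m z) i 0) ^+ 2.
Proof.
transitivity (((M *m z)^T *m (M *m z)) 0 0); last first.
  by rewrite mxE; apply: eq_bigr => i _; rewrite mxE expr2.
rewrite trmx_mul resid_mx_sym mulmxA -(mulmxA z^T) M_idem mxE /resid_form exchange_big /=.
apply: eq_bigr => j _; rewrite mxE mulr_suml; apply: eq_bigr => i _.
by rewrite [z^T _ _]mxE; ring.
Qed.

Lemma resid_form_ge0 z : 0 <= resid_form z.
Proof. by rewrite resid_formE sumr_ge0// => i _; exact: sqr_ge0. Qed.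

Lemma sigma2_hat_model (theta : 'cV[R]_k) s (z : 'cV[R]_n) :
  sigma2_hat X (X *m theta + s *: z) = s ^+ 2 * (resid_form z / (n%:R - k%:R)).
Proof.
rewrite /sigma2_hat theta_LS_model.
have -> : X *m theta + s *: z - X *m (theta + s *: (B *m z)) = s *: (M *m z).
  rewrite mulmxDr -scalemxAr /M mulmxBl mul1mx mulmxA scalerBr.
  by rewrite opprD addrACA subrr add0r.
have -> : (s *: (M *m z))^T = s *: (M *m z)^T by rewrite linearZ.
rewrite -scalemxAl -scalemxAr scalerA; set U := _ *m _.
have -> : (s * s *: U) 0 0 = s * s * U 0 0 by rewrite mxE.
rewrite resid_formE mulrA expr2.
by congr (_ * _ / _); rewrite mxE; apply: eq_bigr => i _; rewrite [(_^T) _ _]mxE expr2.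
Qed.

(** [M] is a symmetric idempotent, so its squared Frobenius norm is tr (M M) = tr M. *)
Lemma sum_sqr_M : \sum_i \sum_j M i j ^+ 2 = n%:R - k%:R.
Proof.
rewrite -mxtrace_resid_mx /mxtrace; apply: eq_bigr => i _; rewrite -[in RHS]M_idem [RHS]mxE.
by apply: eq_bigr => j _; rewrite [M j i]ME expr2.
Qed.

Section coordinate.
Variables (j : 'I_k).

Lemma sum_sqr_B : \sum_i B j i ^+ 2 = invmx (X^T *m X) j j.
Proof. by rewrite -BBT [RHS]mxE; apply: eq_bigr => i _; rewrite [(B^T) _ _]mxE expr2. Qed.

(** The entry is the squared norm of row [j] of [B]; a zero row would contradict B X = 1. *)
Lemma invmx_gram_gt0 : 0 < invmx (X^T *m X) j j.
Proof.
rewrite -sum_sqr_B lt_neqAle sumr_ge0 ?andbT; last by move=> i _; exact: sqr_ge0.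
rewrite eq_sym psumr_eq0; last by move=> i _; exact: sqr_ge0.
apply/negP => /allP B0.
have := congr1 (fun C : 'M[R]_(k, k) => C j j) BX; rewrite !mxE eqxx big1; last first.
  move=> i _; have := B0 i (mem_index_enum i); rewrite /= sqrf_eq0 => /eqP ->.
  by rewrite mul0r.
by move/eqP; rewrite eq_sym oner_eq0.
Qed.

Lemma coordv_ord p (u : 'cV[R]_p) (l : 'I_p) : coordv u l = u l 0.
Proof. by rewrite /coordv valK. Qed.

Lemma xi2_ord : (0 < n)%N -> xi2 X j = n%:R * invmx (X^T *m X) j j.
Proof.
move=> n0; rewrite /xi2 /diagm valK invmxZ; last first.
  by rewrite unitmxZ ?gram_unit// unitfE invr_eq0 pnatr_eq0 -lt0n.
by rewrite invrK mxE.
Qed.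
End coordinate.
End least_squares.

Lemma soft_scale {R : realType} (c b x : R) : c != 0 ->
  c * x * Num.max 0 (1 - c ^+ 2 * b ^+ 2 / (c * x) ^+ 2) = c * soft b x.
Proof.
move=> c0; rewrite /soft -mulrA; congr (_ * (_ * Num.max _ (_ - _))).
by rewrite exprMn -mulf_div divff ?mul1r// expf_neq0.
Qed.

Lemma affine_cover {R : realType} (c s d a p t : R) : 0 < c -> 0 < s ->
  (c * s * p - c * d * a <= t <= c * s * p + c * d * a) =
  (`|p - t / (c * s)| <= d * (a / s)).
Proof.
move=> c0 s0; have cs : 0 < c * s by rewrite mulr_gt0.
have csn0 := lt0r_neq0 cs.
have sn0 := lt0r_neq0 s0.
rewrite -[RHS](ler_pM2l cs) -[X in X * `|_|](gtr0_norm cs) -normrM.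
have -> : c * s * (p - t / (c * s)) = c * s * p - t.
  by rewrite mulrBr mulrCA divff// mulr1.
have -> : c * s * (d * (a / s)) = c * d * a by field.
by rewrite ler_norml; apply/idP/idP => /andP[? ?]; apply/andP; split; lra.
Qed.

Lemma std_gaussE {R : realType} n (A : set 'cV[R]_n) (f : (nat -> R) -> bool) :
  (forall z, A (\col_(l < n) z (nat_of_ord l)) <-> f z) ->
  std_gauss A = gauss_iter n (fun z => (f z)%:R%:E).
Proof.
move=> Af; rewrite /std_gauss; apply: eq_gauss_iter => z; rewrite indicE.
congr ((nat_of_bool _)%:R%:E); by apply/idP/idP; rewrite inE => /Af.
Qed.

(** * Standardisation of the model and of the two infima *)

Section reduction.
Context {R : realType}.
Variables (n k : nat) (X : 'M[R]_(n, k)) (eta a : R) (j : 'I_k).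
Hypothesis rkX : \rank X = k.
Hypothesis kn : (k < n)%N.

Let m : R := n%:R - k%:R.
Let s : R := Num.sqrt (invmx (X^T *m X) j j).
(** The threshold sigma xi eta in units of sigma s, since xi^2 = n s^2. *)
Let b : R := Num.sqrt n%:R * eta.
(** Extension by 0, turning coefficients on ordinals into the [nat]-indexed ones of the iterated
    integrals. *)
Let ext p (f : 'I_p -> R) (i : nat) : R := if insub i is Some l then f l else 0.
Let w : nat -> R := ext _ (fun i => (invmx (X^T *m X) *m X^T) j i / s).
Let Mm i l : R := (1%:M - X *m (invmx (X^T *m X) *m X^T)) i l / m.
Let MM (i l : nat) : R := ext _ (fun i' => ext _ (fun l' => Mm i' l') l) i.
Let D (z : nat -> R) : R := Num.sqrt (resid_form n k X (\col_(i < n) z (nat_of_ord i)) / m).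

Let extE p (f : 'I_p -> R) (i : 'I_p) : ext p f i = f i.
Proof. by rewrite /ext valK. Qed.

Let m0 : 0 < m. Proof. by rewrite subr_gt0 ltr_nat. Qed.

Let s0 : 0 < s. Proof. by rewrite sqrtr_gt0 invmx_gram_gt0. Qed.

Let w1 : \sum_(i < n) w i ^+ 2 = 1.
Proof.
under eq_bigr do rewrite /w extE exprMn.
rewrite -mulr_suml sum_sqr_B// exprVn sqr_sqrtr ?divff//.
  by rewrite gt_eqF// invmx_gram_gt0.
by rewrite ltW// invmx_gram_gt0.
Qed.

Let wE (z : nat -> R) : \sum_(i < n) w i * z i = (invmx (X^T *m X) *m X^T *m (\col_(i < n) z (nat_of_ord i))) j 0 / s.
Proof.
rewrite mxE mulr_suml; apply: eq_bigr => i _; rewrite /w extE [(\col__ _) _ _]mxE; ring.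
Qed.

Let D0 (z : nat -> R) : 0 <= D z. Proof. exact: sqrtr_ge0. Qed.

Let D2 (z : nat -> R) : D z ^+ 2 = resid_form n k X (\col_(i < n) z (nat_of_ord i)) / m.
Proof. by rewrite sqr_sqrtr// divr_ge0 ?resid_form_ge0// ltW. Qed.

Let MM_sym i l : MM i l = MM l i.
Proof.
rewrite /MM /ext; case: insubP => [i' _ _|_]; case: insubP => [l' _ _|_] //.
rewrite /Mm; congr (_ / _); set A := 1%:M - _.
have AT : A^T = A by exact: resid_mx_sym.
by rewrite -[A in RHS]AT [RHS]mxE.
Qed.

Let DE (z : nat -> R) : D z ^+ 2 - 1 = quadf n MM (fun=> 0) (- 1) z.
Proof.
rewrite D2 /quadf [X in _ + X + _]big1 ?addr0; last by move=> i _; rewrite mul0r.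
congr (_ - _); rewrite /resid_form mulr_suml; apply: eq_bigr => i _.
rewrite mulr_suml; apply: eq_bigr => l _; rewrite /MM !extE /Mm.
by rewrite [(\col__ _) _ _]mxE [(\col__ _) l _]mxE; ring.
Qed.

Let mD : coord_measurable D.
Proof.
move=> d T z mz; apply: measurable_sqrtr.
under eq_fun do rewrite -D2 -(subrK 1 (D _ ^+ 2)) DE.
by apply: measurable_funD => //; exact: coord_measurable_quadf.
Qed.

(** D^2 - 1 is a centred quadratic form: the trace of M / m is 1, which cancels the constant -1.
    Only the variance 2 m / m^2 remains. *)
Let Dv : (gauss_iter n (fun z => ((D z ^+ 2 - 1) ^+ 2)%:E) <= (2 / m)%:E)%E.
Proof.
under eq_gauss_iter do rewrite DE.
rewrite gauss_iter_quadf; last exact: MM_sym.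
have mn0 : m != 0 by rewrite gt_eqF.
rewrite [X in _ + X + _]big1 ?addr0; last by move=> i _; rewrite expr0n.
have -> : \sum_(i < n) \sum_(l < n) MM i l ^+ 2 = m^-1.
  under eq_bigr do under eq_bigr do rewrite /MM !extE /Mm exprMn.
  under eq_bigr do rewrite -mulr_suml.
  rewrite -mulr_suml sum_sqr_M// -/m; by field.
have -> : \sum_(i < n) MM i i = 1.
  under eq_bigr do rewrite /MM !extE /Mm.
  by rewrite -mulr_suml -/(\tr _) mxtrace_resid_mx// -/m divff.
by rewrite subrr expr0n addr0.
Qed.

Let sgen (z : nat -> R) sg (theta : 'cV[R]_k) : 0 < sg ->
  coordv (theta_LS X (X *m theta + sg *: \col_(i < n) z (nat_of_ord i))) j =
  sg * s * (coordv theta j / (sg * s) + \sum_(i < n) w i * z i).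
Proof.
move=> sg0; rewrite theta_LS_model// wE !coordv_ord.
move: (_ *m (\col__ _)) => BZ; rewrite !mxE.
have sn0 : s != 0 by rewrite gt_eqF.
by field; rewrite gt_eqF// gt_eqF.
Qed.

(** Stated for any [d], to serve the feasible estimator with [d = D z] and the known-variance one
    with [d = 1]. *)
Let softE (z : nat -> R) sg d (theta : 'cV[R]_k) : 0 < sg ->
  soft_AS X eta (sg ^+ 2 * d ^+ 2) j (X *m theta + sg *: \col_(i < n) z (nat_of_ord i)) =
  sg * s * soft (d * b) (coordv theta j / (sg * s) + \sum_(i < n) w i * z i).
Proof.
move=> sg0; rewrite /soft_AS sgen//.
rewrite -soft_scale ?gt_eqF ?mulr_gt0//.
congr (_ * Num.max _ (_ - _ / _)).
rewrite xi2_ord//; last by rewrite (leq_trans _ kn).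
have s2 : s ^+ 2 = invmx (X^T *m X) j j.
  by rewrite sqr_sqrtr// ltW// invmx_gram_gt0.
have n2 : Num.sqrt n%:R ^+ 2 = n%:R :> R by rewrite sqr_sqrtr.
have -> : n%:R * invmx (X^T *m X) j j = Num.sqrt n%:R ^+ 2 * s ^+ 2 by rewrite n2 s2.
by rewrite /b; ring.
Qed.

Lemma Pmodel_E_AS theta sg : 0 < sg ->
  Pmodel X theta sg (E_AS X eta a j theta) =
  cov_feasible n w D b (a / s) (coordv theta j / (sg * s)).
Proof.
move=> sg0; apply: std_gaussE => z; rewrite /= /E_AS /= /ttheta_AS sigma2_hat_model//.
rewrite -/m -D2 softE// sqrtrM ?sqr_ge0// !sqrtr_sqr.
rewrite (ger0_norm (ltW sg0)) (ger0_norm (D0 z)).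
by rewrite affine_cover.
Qed.

Lemma Pmodel_C_AS theta sg : 0 < sg ->
  Pmodel X theta sg (C_AS X eta sg a j theta) =
  cov_known n w b (a / s) (coordv theta j / (sg * s)).
Proof.
move=> sg0; apply: std_gaussE => z; rewrite /= /C_AS /= /theta_AS.
have -> : sg ^+ 2 = sg ^+ 2 * 1 ^+ 2 by rewrite expr1n mulr1.
rewrite softE// mul1r.
have -> : sg * a = sg * 1 * a by rewrite mulr1.
by rewrite affine_cover// mul1r.
Qed.

Let theta_of t sg : 0 < sg -> coordv (const_mx (t * (sg * s)) : 'cV[R]_k) j / (sg * s) = t.
Proof. by move=> sg0; rewrite coordv_ord mxE mulfK// mulf_neq0// gt_eqF. Qed.

(** The coverage depends on [theta] and the error scale only through t = theta_j / (sg s), which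
    takes every real value already at scale 1. The infimum over the scale therefore disappears. *)
Lemma inf_cov_E_range :
  inf_cov_E X eta a j = ereal_inf (range (cov_feasible n w D b (a / s))).
Proof.
rewrite /inf_cov_E; congr ereal_inf; apply/seteqP; split=> [x [theta _ [sg sg0 <-]]|_ [t _ <-]].
  by rewrite Pmodel_E_AS//; exists (coordv theta j / (sg * s)).
exists (const_mx (t * (1 * s))) => //; exists 1; first exact: ltr01.
by rewrite Pmodel_E_AS ?theta_of.
Qed.

Lemma inf_cov_C_range sg : 0 < sg ->
  inf_cov_C X eta sg a j = ereal_inf (range (cov_known n w b (a / s))).
Proof.
move=> sg0; rewrite /inf_cov_C; congr ereal_inf; apply/seteqP; split=> [x [theta _ <-]|_ [t _ <-]].
  by rewrite Pmodel_C_AS//; exists (coordv theta j / (sg * s)).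
by exists (const_mx (t * (sg * s))) => //; rewrite Pmodel_C_AS ?theta_of.
Qed.

Hypotheses (eta0 : 0 <= eta) (a0 : 0 <= a).

Let b0 : 0 <= b. Proof. by rewrite mulr_ge0 ?sqrtr_ge0. Qed.
Let al0 : 0 <= a / s. Proof. by rewrite divr_ge0// ltW. Qed.

(** With its feasible counterpart, this makes both infima finite, so that their extended-real
    difference can be handled in the reals. *)
Lemma inf_cov_C_01 sg : 0 < sg -> (0 <= inf_cov_C X eta sg a j <= 1)%E.
Proof.
move=> sg0; rewrite inf_cov_C_range//; apply/andP; split.
  by apply: le_ereal_inf_tmp => _ [t _ <-]; apply: gauss_iter_ge0 => z; rewrite lee_fin.
apply: (@le_trans _ _ (cov_known n w b (a / s) 0)).
  by apply: ereal_inf_lbound; exists 0.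
exact: cov_known_le1.
Qed.

Lemma inf_cov_E_01 : (0 <= inf_cov_E X eta a j <= 1)%E.
Proof.
rewrite inf_cov_E_range//; apply/andP; split.
  by apply: le_ereal_inf_tmp => _ [t _ <-]; apply: gauss_iter_ge0 => z; rewrite lee_fin.
apply: (@le_trans _ _ (cov_feasible n w D b (a / s) 0)).
  by apply: ereal_inf_lbound; exists 0.
by apply: cov_feasible_le1.
Qed.

Lemma inf_cov_dist sg g del : 0 < sg -> 0 < g -> 0 < del ->
  (`|inf_cov_E X eta a j - inf_cov_C X eta sg a j| <=
   (12 * del + g ^- 2 + 4 * (2 / (n%:R - k%:R)) +
    ((3 * (Num.sqrt n%:R * eta) + 2 * g) / del) ^+ 2 * (2 / (n%:R - k%:R)))%:E)%E.
Proof.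
move=> sg0 g0 del0.
have [h1 h2] := inf_cov_close n w D (2 / m) w1 D0 mD Dv b (a / s) b0 al0 g del g0 del0.
rewrite -inf_cov_E_range -(inf_cov_C_range _ sg0) in h1 h2.
move: (inf_cov_C_01 _ sg0) inf_cov_E_01 h1 h2; rewrite -/m -/b.
case: (inf_cov_E _ _ _ _) => [x||]; rewrite ?leye_eq ?leeNy_eq ?andbF//.
case: (inf_cov_C _ _ _ _ _) => [y||]; rewrite ?leye_eq ?leeNy_eq ?andbF// => _ _.
rewrite -!EFinD !lee_fin => h1 h2; rewrite ler_norml; apply/andP; split; lra.
Qed.
End reduction.

(** * Passage to the limit *)

Lemma cvge0_abse_le {R : realType} (f : nat -> \bar R) :
  (forall e : R, 0 < e -> \forall n \near \oo, (`|f n| <= e%:E)%E) ->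
  f @ \oo --> 0%E.
Proof.
move=> fe; apply/fine_cvgP; split.
  apply: filterS (fe _ ltr01) => n h.
  by rewrite fin_num_abs (le_lt_trans h)// ltry.
apply/cvgr0Pnorm_le => e e0; apply: filterS (fe _ e0) => n h /=.
have fn : f n \is a fin_num by rewrite fin_num_abs (le_lt_trans h)// ltry.
by rewrite -lee_fin -fine_abse//= fineK// abse_fin_num.
Qed.

(** Separates the error into terms in 1 / m and b / sqrt m, which are the quantities assumed to tend
    to 0. The square is split by (3 b - 2 g)^2 >= 0. *)
Lemma deviation_le {R : realType} (b g del m : R) : 0 < m ->
  4 * (2 / m) + ((3 * b + 2 * g) / del) ^+ 2 * (2 / m) <=
  8 * m^-1 + del ^- 2 * (36 * (b / Num.sqrt m) ^+ 2 + 16 * g ^+ 2 * m^-1).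
Proof.
move=> m0; have mi0 : 0 < m^-1 by rewrite invr_gt0.
rewrite [(b / _) ^+ 2]exprMn [(_ / del) ^+ 2]exprMn !exprVn sqr_sqrtr ?(ltW m0)//.
have h : (3 * b + 2 * g) ^+ 2 <= 18 * b ^+ 2 + 8 * g ^+ 2.
  have := sqr_ge0 (3 * b - 2 * g); lra.
have d0 : 0 <= del ^- 2 by rewrite invr_ge0 sqr_ge0.
have := ler_wpM2r (mulr_ge0 d0 (ltW mi0)) h.
lra.
Qed.

(* The paper's index i (1-based) corresponds to the 0-based coordinate i.-1. *)
Theorem theorem19 (R : realType) (k : nat -> nat) (X : forall n : nat, 'M[R]_(n, k n))
  (i : nat) (eta a : nat -> R) (sigma : R) :
  (0 < i)%N ->
  (\forall n \near \oo, (i <= k n)%N) ->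
  (\forall n \near \oo, \rank (X n) = k n) ->
  (exists C : R, \forall n \near \oo, xi2 (X n) i.-1 / n%:R <= C) ->
  (forall n, 0 < eta n) ->
  (forall n, 0 <= a n) ->
  (fun n => xi (X n) i.-1 * eta n) @ \oo --> (0 : R) ->
  (fun n => n%:R - (k n)%:R : R) @ \oo --> +oo ->
  (fun n => Num.sqrt n%:R * eta n / Num.sqrt (n%:R - (k n)%:R)) @ \oo --> (0 : R) ->
  0 < sigma ->
  (fun n => (inf_cov_E (X n) (eta n) (a n) i.-1
             - inf_cov_C (X n) (eta n) sigma (a n) i.-1)%E) @ \oo --> 0%E.

Proof.
move=> i0 ik rk _ eta0 a0 _ minf bm sg0.
apply: cvge0_abse_le => e e0.
(* These choices make 12 del and g^-2 equal to e / 4 each, leaving e / 2 for the part that vanishes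
   with n. *)
pose del := e / 48; pose g : R := 2 / Num.sqrt e.
have del0 : 0 < del by rewrite divr_gt0.
have g0 : 0 < g by rewrite divr_gt0// sqrtr_gt0.
have gE : g ^- 2 = e / 4.
  by rewrite /g -exprVn invf_div exprMn exprVn sqr_sqrtr ?(ltW e0)//; congr (_ / _); ring.
pose m n : R := n%:R - (k n)%:R.
(* With [del] and [g] fixed, [u] is the bound of [deviation_le] and tends to 0. *)
pose u n := 8 * (m n)^-1 + del ^- 2 *
  (36 * (Num.sqrt n%:R * eta n / Num.sqrt (m n)) ^+ 2 + 16 * g ^+ 2 * (m n)^-1).
have mpos : \forall n \near \oo, 0 < m n by apply: (cvgryPgt m).1.
have minv : (m n)^-1 @[n --> \oo] --> (0 : R) by apply/gtr0_cvgV0.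
have u0 : u n @[n --> \oo] --> (0 : R).
  have -> : 0 = 8 * 0 + del ^- 2 * (36 * 0 ^+ 2 + 16 * g ^+ 2 * 0) :> R.
    by ring.
  apply: cvgD; first by apply: cvgM => //; exact: cvg_cst.
  apply: cvgM; first exact: cvg_cst.
  apply: cvgD; last by apply: cvgM => //; exact: cvg_cst.
  apply: cvgM; first exact: cvg_cst.
  by rewrite expr2; under eq_fun do rewrite expr2; exact: cvgM.
have ule : \forall n \near \oo, `|u n| <= e / 2.
  by move/cvgr0Pnorm_le : u0; apply; rewrite divr_gt0.
near=> n.
have ikn : (i.-1 < k n)%N by rewrite prednK//; near: n.
have rkn : \rank (X n) = k n by near: n.
have mn0 : 0 < m n by near: n.
have kn : (k n < n)%N by rewrite -(ltr_nat R) -subr_gt0.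
have un : `|u n| <= e / 2 by near: n.
apply: (le_trans (inf_cov_dist _ _ (X n) (eta n) (a n) (Ordinal ikn) rkn kn
  (ltW (eta0 n)) (a0 n) sigma g del sg0 g0 del0)).
rewrite lee_fin gE -addrA.
apply: (@le_trans _ _ (12 * del + e / 4 + u n)).
  by rewrite lerD2l; exact: deviation_le.
have := le_trans (ler_norm _) un; rewrite /del; lra.
Unshelve. all: by end_near. Qed.
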